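(* Let $n\ge 2$, let $r>2$ be an integer, and let $V_n=(M,g)$ and $\bar V_n=(\bar M,\bar g)$ be $n$-dimensional (pseudo-)Riemannian manifolds with $V_n\in C^r$ and $\bar V_n\in C^2$. If $V_n$ admits a geodesic mapping onto $\bar V_n$, then $\bar V_n\in C^r$.
   Context: For a (pseudo-)Riemannian manifold $V_n=(M,g)$, the notation $V_n\in C^r$ means that the metric $g$ is of class $C^r$, i.e. its components $g_{ij}$ in local coordinates are functions of class $C^r$; likewise $\bar V_n\in C^r$ means $\bar g_{ij}\in C^r$. Metrics are nondegenerate symmetric and of arbitrary signature. A diffeomorphism $f\colon V_n\to\bar V_n$ is called a geodesic mapping of $V_n$ onto $\bar V_n$ if $f$ maps any geodesic of $V_n$ onto a geodesic of $\bar V_n$; here geodesics are considered as unparametrized curves. Since $f$ is a diffeomorphism, one uses local coordinates on $M$ and $\bar M$ in which $f$ maps points to points with the same coordinates, and thus identifies $\bar M=M$; smoothness classes of $\bar g_{ij}$ refer to such coordinates. With this identification, $f$ is a geodesic mapping if and only if the Levi-Civita equations $\bar\nabla_XY=\nabla_XY+\psi(X)Y+\psi(Y)X$ hold for all tangent vector fields $X,Y$, where $\nabla,\bar\nabla$ are the Levi-Civita connections of $g,\bar g$ and $\psi$ is a differential $1$-form. *)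

(* Defs.v *)
From HB Require Import structures.
From mathcomp Require Import all_boot all_order all_algebra.
From mathcomp Require Import all_classical all_reals all_analysis.

Set Implicit Arguments.
Unset Strict Implicit.
Unset Printing Implicit Defensive.

Import Order.TTheory GRing.Theory Num.Theory.
Import numFieldNormedType.Exports.

Local Open Scope ring_scope.
Local Open Scope classical_set_scope.

Section Calculus.
Context {R : realType} {n : nat}.

Definition partial (i : 'I_n) (f : 'rV[R]_n -> R) : 'rV[R]_n -> R :=
  fun x => 'D_(delta_mx 0 i) f x.

(* Meant for open U: the partial derivatives of f of order at most k exist and
   are continuous on U. *)
Fixpoint Ck (k : nat) (U : set 'rV[R]_n) (f : 'rV[R]_n -> R) : Prop :=
  (forall x, U x -> {for x, continuous f}) /\
  (if k is k'.+1 then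
     forall i, (forall x, U x -> derivable f x (delta_mx 0 i)) /\
               Ck k' U (partial i f)
   else True).

Definition Ckmap m (k : nat) (U : set 'rV[R]_n) (f : 'rV[R]_n -> 'rV[R]_m) :=
  forall j, Ck k U (fun x => f x 0 j).

(* Christoffel symbol of the second kind, Gamma^k_{ij}. *)
Definition christoffel (G : 'rV[R]_n -> 'M[R]_n) (k i j : 'I_n)
    (x : 'rV[R]_n) : R :=
  2^-1 * \sum_l invmx (G x) k l *
    (partial i (fun y => G y j l) x + partial j (fun y => G y i l) x
     - partial l (fun y => G y i j) x).

End Calculus.

(* [chart_inv] is only meaningful on the image of the chart. *)
Record chart (R : realType) (n : nat) (M : topologicalType) := Chart {
  chart_dom : set M;
  chart_map :> M -> 'rV[R]_n;
  chart_inv : 'rV[R]_n -> M;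
  chart_domO : open chart_dom;
  chart_codO : open (chart_map @` chart_dom);
  chart_invK : {in chart_dom, cancel chart_map chart_inv};
  chart_cts : forall p, chart_dom p -> {for p, continuous chart_map};
  chart_inv_cts : forall x, (chart_map @` chart_dom) x ->
    {for x, continuous chart_inv}
}.

Definition chart_cod (R : realType) (n : nat) (M : topologicalType)
  (c : chart R n M) : set 'rV[R]_n := c @` chart_dom c.

(* The expression d o f o c^-1 of f : M -> N in the charts c, d, and the subset
   of the image of c on which it is defined. *)
Definition in_charts (R : realType) (n m : nat) (M N : topologicalType)
    (c : chart R n M) (d : chart R m N) (f : M -> N)
  : 'rV[R]_n -> 'rV[R]_m := d \o f \o chart_inv c.

Definition in_charts_dom (R : realType) (n m : nat) (M N : topologicalType)
    (c : chart R n M) (d : chart R m N) (f : M -> N) : set 'rV[R]_n :=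
  c @` (chart_dom c `&` f @^-1` chart_dom d).

(* Manifold of class C^k.  The atlas is not required to be maximal, so every
   C^l manifold with l >= k (l = oo included) is an instance. *)
Record manifold (R : realType) (n k : nat) := Manifold {
  mcarrier :> topologicalType;
  manifold_hausdorff : hausdorff_space mcarrier;
  manifold_second_countable : @second_countable mcarrier;
  atlas : set (chart R n mcarrier);
  atlas_cover : forall p, exists2 c, atlas c & chart_dom c p;
  atlas_compat : forall c d, atlas c -> atlas d ->
    Ckmap k (in_charts_dom c d idfun) (in_charts c d idfun)
}.

(* Pseudo-Riemannian metric of arbitrary signature: a covariant symmetric
   nondegenerate 2-tensor, given by its matrix of components in every chart of
   the atlas.  The Jacobian matrix ['J] acts on row vectors on the right, so the
   law g_ij = d_i y^a d_j y^b g'_ab reads G = J G' J^T. *)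
Record metric (R : realType) (n k : nat) (M : manifold R n k) := Metric {
  gcomp :> chart R n M -> 'rV[R]_n -> 'M[R]_n;
  metric_sym : forall c x, atlas c -> chart_cod c x -> (gcomp c x)^T = gcomp c x;
  metric_nondeg : forall c x, atlas c -> chart_cod c x -> gcomp c x \in unitmx;
  metric_change : forall c d x, atlas c -> atlas d ->
    in_charts_dom c d idfun x ->
    let y := in_charts c d idfun in
    gcomp c x = jacobian y x *m gcomp d (y x) *m (jacobian y x)^T
}.

Definition metric_class (R : realType) (n k : nat) (M : manifold R n k)
    (s : nat) (g : metric M) : Prop :=
  forall c, atlas c -> forall i j, Ck s (chart_cod c) (fun x => g c x i j).

Section GeodesicMappings.
Context {R : realType} {n k : nat}.

(* Affinely parametrized nonconstant geodesics, on nonempty open intervals.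
   As I is open and the conditions hold at every t in I, the first derivatives
   exist on a neighbourhood of t. *)
Definition geodesic (M : manifold R n k) (g : metric M)
    (I : set R) (gamma : R -> M) : Prop :=
  [/\ open I, is_interval I & I !=set0] /\
  forall t, I t ->
    {for t, continuous gamma} /\
    forall c : chart R n M, atlas c -> chart_dom c (gamma t) ->
      let u (i : 'I_n) (s : R) := c (gamma s) 0 i in
      let du (i : 'I_n) := derive1 (u i) in
      [/\ forall i, derivable (u i) t 1 /\ derivable (du i) t 1,
          exists i, du i t != 0
        & forall l, derive1 (du l) t +
            \sum_i \sum_j christoffel (g c) l i j (c (gamma t)) *
                          du i t * du j t = 0].

(* (I, gamma) and (J, delta) parametrize the same unparametrized curve: delta is
   obtained from gamma by a regular change of parameter. *)
Definition same_curve (T : Type) (I : set R) (gamma : R -> T)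
    (J : set R) (delta : R -> T) : Prop :=
  exists2 phi : R -> R, phi @` J = I &
    forall t, J t ->
      [/\ derivable phi t 1, derive1 phi t != 0 & delta t = gamma (phi t)].

Definition Ckmorphism (M N : manifold R n k) (f : M -> N) : Prop :=
  continuous f /\
  forall (c : chart R n M) (d : chart R n N), atlas c -> atlas d ->
    Ckmap k (in_charts_dom c d f) (in_charts c d f).

Definition diffeomorphism (M N : manifold R n k) (f : M -> N) : Prop :=
  Ckmorphism f /\
  exists h : N -> M, [/\ cancel f h, cancel h f & Ckmorphism h].

Definition geodesic_mapping (M N : manifold R n k) (g : metric M)
    (g' : metric N) (f : M -> N) : Prop :=
  diffeomorphism f /\
  forall (I : set R) (gamma : R -> M), geodesic g I gamma ->
    exists J : set R, exists2 delta : R -> N,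
      geodesic g' J delta & same_curve I (f \o gamma) J delta.

End GeodesicMappings.

(* Main.v *)
From HB Require Import structures.
Require Import Defs.
From mathcomp Require Import all_boot all_order all_algebra.
From mathcomp Require Import all_classical all_reals all_analysis.
From mathcomp Require Import ring lra.

Set Implicit Arguments.
Unset Strict Implicit.
Unset Printing Implicit Defensive.

Import Order.TTheory GRing.Theory Num.Theory.
Import numFieldNormedType.Exports.

Local Open Scope ring_scope.
Local Open Scope classical_set_scope.

(** A geodesic mapping transmits regularity because the contravariant target metric
    and an auxiliary vector field satisfy first-order equations in which only the
    source metric is differentiated; from these each gains one derivative at a time.

    Work in a chart of M and let Gb be the pullback of g' there, of class C^2, while
    G, the matrix of g, is C^r.  Through every point and in every direction v there
    is a geodesic of G ([geodesic_existence], by Picard iteration).  By hypothesis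
    it is a reparametrized geodesic of Gb, so the difference of the two Christoffel
    symbols, contracted twice with v, is a multiple of v ([reparametrized_jet]).
    Polarization ([projective_quadratic]) gives the Levi-Civita equations
      Gamma(Gb)^k_ij - Gamma(G)^k_ij = delta^k_i psi_j + delta^k_j psi_i.

    Let b be the inverse of Gb and lam^i = - b^il psi_l.  The Levi-Civita equations
    become
      d_k b^ij = lam^i delta^j_k + lam^j delta^i_k - 2 psi_k b^ij - S_k^ij,
    with S linear in b and in the Christoffel symbols of G.  Moreover psi is closed,
    being the gradient of a combination of log |det Gb| and log |det G|.  Equating
    the mixed derivatives of b therefore expresses d_m lam^k for m <> k, and the
    differences d_m lam^m - d_k lam^k, without derivatives of lam or psi.  A vector
    field whose first derivatives are of class C^s up to a multiple of the identity
    is itself of class C^(s+1) if s >= 1: the version [partial_swap] of Schwarz's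
    theorem, in which the existence of one mixed derivative is a conclusion, gives
    the missing second derivatives ([Ck_gain_diagonal], where n >= 2 is needed).  So lam gains a derivative, then b
    does by the displayed equation, and the bootstrap goes on until b is C^r
    ([levi_civita_regularity]).  The starting point, b in C^2 and lam in C^1, needs
    Christoffel symbols of class C^2, that is r > 2.

    To move between charts and between the two manifolds one needs that changes of
    coordinates carry geodesics to geodesics.  This is proved for the Euler-Lagrange
    form of the equation, where the terms with second derivatives of the change of
    coordinates visibly cancel ([lagrange_row_pullback], [spray_transport]). *)

(** * Mean value estimates *)

Section OneVariable.
Context {R : realType}.

Lemma bounded_derivative_lipschitz (f : R -> R) (C a b : R) :
  (forall t, Num.min a b <= t <= Num.max a b ->
     derivable f t 1 /\ `|'D_1 f t| <= C) ->
  `|f b - f a| <= C * `|b - a|.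
Proof.
wlog ab : a b / a <= b => [H|].
  have [/H//|ba df] := orP (le_total a b).
  by rewrite distrC (distrC b); apply: H => // t; rewrite minC maxC; exact: df.
rewrite (min_l ab) (max_r ab) => df.
have df1 t : t \in `]a, b[%R -> is_derive t 1 f ('D_1 f t).
  by move=> tab; apply/derivableP/(df t _).1; rewrite !(itvP tab).
have fc : {within `[a, b], continuous f}.
  by apply: derivable_within_continuous => t tab; apply: (df t _).1; rewrite !(itvP tab).
have [c cab ->] := MVT_segment ab df1 fc.
by rewrite normrM ler_wpM2r ?normr_ge0//; apply: (df c _).2; rewrite !(itvP cab).
Qed.

Lemma derivative_bound (g : R -> R) (d C r : R) : 0 < r ->
  is_derive (0 : R) (1 : R) g d ->
  (forall k, `|k| < r -> `|g k - g 0| <= C * `|k|) -> `|d| <= C.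
Proof.
move=> r0 [gd <-] gC.
have lim_n := cvg_norm gd.
apply: (ler_cvg_to (lim_n _) (cvg_cst C)); near=> k.
have k0 : k != 0 by near: k; exact: nbhs_dnbhs_neq.
rewrite /= [k *: 1]mulr1 addr0 normrM normfV ler_pdivrMl ?normr_gt0// mulrC.
by apply: gC; near: k; exact: dnbhs0_lt.
Unshelve. all: by end_near. Qed.

Lemma is_derive_scale (a t : R) : is_derive t (1 : R) (fun s : R => s * a) a.
Proof.
have h := is_deriveM (is_derive_id t (1 : R)) (is_derive_cst a t (1 : R)).
by apply: (is_derive_eq h); rewrite scaler0 add0r [a *: 1]mulr1.
Qed.

End OneVariable.

Lemma is_derive_of_bound {R : realType} {V : normedModType R} (f : V -> R) x v A :
  (forall eps : R, 0 < eps -> exists2 r : R, 0 < r & forall h : R, `|h| < r ->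
     `|f (x + h *: v) - f x - h * A| <= eps * `|h|) ->
  is_derive x v f A.
Proof.
move=> fA.
suff H : (fun h : R => h^-1 *: (f (h *: v + x) - f x)) @ 0^' --> A.
  by apply: DeriveDef; [apply/cvg_ex; exists A|exact/cvg_lim].
apply/cvgrPdist_le => eps eps0; have [r r0 rP] := fA _ eps0.
near=> h.
have h0 : h != 0 by near: h; exact: nbhs_dnbhs_neq.
have hr : `|h| < r by near: h; exact: dnbhs0_lt.
have := rP h hr; rewrite (addrC x) -ler_pdivrMr ?normr_gt0//; apply: le_trans.
rewrite -normfV -normrM distrC; rewrite le_eqVlt; apply/orP; left; apply/eqP; congr (`|_|).
by rewrite /GRing.scale/= [RHS]mulrBl [h * A]mulrC mulfK// mulrC.
Unshelve. all: by end_near. Qed.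


Section Lines.
Context {R : numFieldType} {V W : normedModType R}.
Implicit Types (f : V -> W) (x v : V) (t : R).

Let growth_line f x v t :
  (fun h : R => h^-1 *: ((fun s : R => f (x + s *: v)) (h *: (1 : R) + t) - f (x + t *: v)))
  = (fun h : R => h^-1 *: (f (h *: v + (x + t *: v)) - f (x + t *: v))).
Proof.
apply/funext => h; do 3 f_equal.
by rewrite [h *: 1]mulr1 scalerDl addrCA.
Qed.

Lemma derivable_line f x v t :
  derivable (fun s : R => f (x + s *: v)) t 1 <-> derivable f (x + t *: v) v.
Proof. by rewrite /derivable growth_line. Qed.

Lemma derive_line f x v t :
  'D_1 (fun s : R => f (x + s *: v)) t = 'D_v f (x + t *: v).
Proof. by rewrite /derive growth_line. Qed.

Lemma derivable_line0 f x v :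
  derivable (fun s : R => f (x + s *: v)) 0 1 <-> derivable f x v.
Proof. by have := derivable_line f x v 0; rewrite scale0r addr0. Qed.

Lemma derive_line0 f x v :
  'D_1 (fun s : R => f (x + s *: v)) 0 = 'D_v f x.
Proof. by have := derive_line f x v 0; rewrite scale0r addr0. Qed.

End Lines.

Section RowVectors.
Context {R : realType} {n : nat}.
Local Notation e_ i := (delta_mx 0 i : 'rV[R]_n).

Lemma row_ballP (x y : 'rV[R]_n) (e : R) : 0 < e ->
  ball x e y <-> forall i, `|x 0 i - y 0 i| < e.
Proof.
move=> e0; split => [[_ H] i|H]; first by have := H 0 i.
by split=> // i j; rewrite ord1; exact: H.
Qed.

Lemma row_norm_coord (x : 'rV[R]_n) i : `|x 0 i| <= `|x|.
Proof.
rewrite [leRHS]/Num.norm/= mx_normrE.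
exact: (le_bigmax _ (fun p => `|x p.1 p.2|) (0, i)).
Qed.

Lemma row_norm_le (x : 'rV[R]_n) C : 0 <= C -> (forall i, `|x 0 i| <= C) -> `|x| <= C.
Proof.
move=> C0 xC; rewrite [leLHS]/Num.norm/= mx_normrE; apply: bigmax_le => //.
by move=> [i j] _ /=; rewrite ord1.
Qed.

(** Two points of a sup-norm ball can be joined by changing one coordinate at a
    time without leaving the ball; each change costs a one-variable mean value
    estimate. *)
Lemma partial_bound_lipschitz (f : 'rV[R]_n -> R) (x0 : 'rV[R]_n) (e C : R) :
  (forall x, ball x0 e x -> forall i,
     derivable f x (e_ i) /\ `|partial i f x| <= C) ->
  forall x y, ball x0 e x -> ball x0 e y ->
    `|f y - f x| <= n%:R * C * `|y - x|.
Proof.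
move=> df x y xe ye.
have e0 : 0 < e by case: xe.
pose z k : 'rV[R]_n := \row_j (if (j < k)%N then y 0 j else x 0 j).
have step (i : 'I_n) : `|f (z i.+1) - f (z i)| <= C * `|y - x|.
  have zS : z i.+1 = z i + (y 0 i - x 0 i) *: e_ i.
    apply/rowP => j; rewrite !mxE ltnS leq_eqVlt.
    have [->|ji] := eqVneq j i; first by rewrite !eqxx ltnn/= mulr1 subrKC.
    by rewrite (negbTE ji : (_ == _ :> nat) = false) andbF mulr0 addr0.
  pose w t := z i + t *: e_ i.
  have wb t : Num.min 0 (y 0 i - x 0 i) <= t <= Num.max 0 (y 0 i - x 0 i) ->
      ball x0 e (w t).
    move=> tb; apply/row_ballP => // j.
    have /row_ballP/(_ j) := ye; have /row_ballP/(_ j) := xe.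
    move=> /(_ e0) xj /(_ e0) yj; rewrite !mxE.
    have [ji|ji] := eqVneq j i; last by rewrite andbF mulr0 addr0; case: ifP.
    rewrite ji ltnn mulr1 in xj yj *.
    move: tb xj yj; rewrite !ltr_norml => /andP[].
    by rewrite ge_min le_max => /orP[] h1 /orP[] h2 /andP[? ?] /andP[? ?]; apply/andP; split; lra.
  have -> : z i.+1 = w (y 0 i - x 0 i) by [].
  have -> : z i = w 0 by rewrite /w scale0r addr0.
  apply: le_trans (_ : C * `|(y 0 i - x 0 i) - 0| <= _).
    apply: (@bounded_derivative_lipschitz _ (f \o w)) => t /wb wt.
    have [d1 d2] := df _ wt i; split; first exact/derivable_line.
    by rewrite derive_line.
  have C0 : 0 <= C by rewrite (le_trans _ (df _ xe i).2).
  by rewrite subr0 ler_wpM2l// (le_trans _ (row_norm_coord _ i))// !mxE.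
have -> : f y - f x = \sum_(i < n) (f (z i.+1) - f (z i)).
  rewrite -(big_mkord xpredT (fun i => f (z i.+1) - f (z i))) telescope_sumr//.
  by congr (f _ - f _); apply/rowP => j; rewrite !mxE// ltn_ord.
apply: (le_trans (ler_norm_sum _ _ _)).
apply: (le_trans (ler_sum _ (fun i _ => step i))).
by rewrite sumr_const card_ord -mulrA mulr_natl.
Qed.

End RowVectors.

(** * Functions with continuous partial derivatives *)

Section PointwiseForms.
Context {R : realType}.

Section Continuity.
Context {T : topologicalType}.
Implicit Types (f g : T -> R) (x : T).

(** Eta-expanded forms of the usual rules, for functions given by a formula. *)
Lemma continuous_at_add f g x : {for x, continuous f} -> {for x, continuous g} ->
  {for x, continuous (fun y => f y + g y)}.
Proof. by move=> cf cg; exact: (continuousD cf cg). Qed.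

Lemma continuous_at_mul f g x : {for x, continuous f} -> {for x, continuous g} ->
  {for x, continuous (fun y => f y * g y)}.
Proof. by move=> cf cg; exact: (continuousM cf cg). Qed.

End Continuity.

Section Derivatives.
Context {V : normedModType R}.
Implicit Types (f g : V -> R) (x v : V) (df dg : R).

Lemma is_derive_add f g x v df dg : is_derive x v f df -> is_derive x v g dg ->
  is_derive x v (fun y => f y + g y) (df + dg).
Proof. by move=> hf hg; exact: (is_deriveD hf hg). Qed.

Lemma is_derive_sub f g x v df dg : is_derive x v f df -> is_derive x v g dg ->
  is_derive x v (fun y => f y - g y) (df - dg).
Proof. by move=> hf hg; exact: (is_deriveB hf hg). Qed.

Lemma is_derive_mul f g x v df dg : is_derive x v f df -> is_derive x v g dg ->
  is_derive x v (fun y => f y * g y) (df * g x + f x * dg).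
Proof.
move=> hf hg; apply: (is_derive_eq (is_deriveM hf hg)).
by rewrite addrC mulrC.
Qed.

Lemma is_derive_inv f x v df : f x != 0 -> is_derive x v f df ->
  is_derive x v (fun y => (f y)^-1) (- (f x)^-1 ^+ 2 * df).
Proof.
move=> f0 [hf <-]; apply: DeriveDef; first exact: derivableV.
by rewrite deriveV// exprVn.
Qed.

Lemma is_derive_bigsum (I : Type) (r : seq I) (P : pred I) (F : I -> V -> R) (dF : I -> R) x v :
  (forall i, is_derive x v (F i) (dF i)) ->
  is_derive x v (fun y => \sum_(i <- r | P i) F i y) (\sum_(i <- r | P i) dF i).
Proof.
move=> hF; elim: r => [|i r IH].
  rewrite big_nil; under eq_fun do rewrite big_nil; exact: is_derive_cst.
rewrite big_cons; under eq_fun do rewrite big_cons.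
by case: ifP => // _; apply: is_derive_add.
Qed.

End Derivatives.

Lemma partialE (n : nat) (f : 'rV[R]_n -> R) i (x : 'rV[R]_n) d :
  is_derive x (delta_mx 0 i : 'rV[R]_n) f d -> partial i f x = d.
Proof. by move=> [_]. Qed.

End PointwiseForms.

Section C1Differentiable.
Context {R : realType} {n : nat}.
Local Notation e_ i := (delta_mx 0 i : 'rV[R]_n).

Lemma continuous_rV_coord {T : topologicalType} (g : T -> 'rV[R]_n) t :
  (forall i, {for t, continuous (fun s => g s 0 i)}) -> {for t, continuous g}.
Proof.
move=> gc; apply/cvg_ballP => e e0.
have H i : \forall s \near t, `|g t 0 i - g s 0 i| < e.
  by have /cvgrPdist_lt/(_ _ e0) := gc i.
near=> s; apply/row_ballP => //.
by near: s; apply: filter_forall.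
Unshelve. all: by end_near. Qed.

Definition gradient_form (f : 'rV[R]_n -> R) x (v : 'rV[R]_n) : R :=
  \sum_i v 0 i * partial i f x.

Fact gradient_form_linear f x : linear (gradient_form f x).
Proof.
move=> a u v; rewrite /gradient_form scaler_sumr -big_split; apply: eq_bigr => i _.
by rewrite !mxE mulrDl scalerAl.
Qed.

HB.instance Definition _ f x := GRing.isLinear.Build R 'rV[R]_n R _
  (gradient_form f x) (gradient_form_linear f x).

Fact gradient_form_continuous f x : continuous (gradient_form f x).
Proof.
apply: (@continuous_big _ _ _ _ _ _ _ _ (fun i (v : 'rV[R]_n) => v 0 i * partial i f x)).
  exact: add_continuous.
move=> i _ v; apply: (@continuous_at_mul _ _ (fun v : 'rV[R]_n => v 0 i)).
  exact: coord_continuous.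
exact: cst_continuous.
Qed.

(** After subtraction of the candidate differential the partial derivatives are
    small near x, so the Lipschitz estimate bounds the remainder. *)
Lemma is_diff_of_continuous_partials (f : 'rV[R]_n -> R) x :
  (\forall y \near x, forall i, derivable f y (e_ i)) ->
  (forall i, {for x, continuous (partial i f)}) ->
  is_diff x f (gradient_form f x).
Proof.
move=> df cf.
have eqo : f \o shift x = cst (f x) + (gradient_form f x) +o_ 0 id.
  apply/eqaddoP => e e0.
  pose e' := e / (n%:R + 1).
  have n1 : 0 < n%:R + 1 :> R by rewrite ltr_wpDl.
  have e'0 : 0 < e' by rewrite divr_gt0.
  have /nbhs_ballP[r/= r0 rP] : \forall y \near x,
      forall i, derivable f y (e_ i) /\ `|partial i f y - partial i f x| <= e'.
    have H : \forall y \near x, forall i, `|partial i f y - partial i f x| <= e'.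
      apply: (@filter_forall _ _ (fun i y => `|partial i f y - partial i f x| <= e') (nbhs x)).
      move=> i; have /cvgrPdist_le/(_ _ e'0) := cf i.
      by apply: filterS => y; rewrite distrC.
    by apply: filterS2 _ df H => y d1 d2 i.
  pose g y := f y - gradient_form f x y.
  have glip y z : ball x r y -> ball x r z -> `|g z - g y| <= n%:R * e' * `|z - y|.
    apply: partial_bound_lipschitz => {}y yr i; have [dfy bd] := rP _ yr i.
    have dL v : is_derive y v (gradient_form f x) (gradient_form f x v).
      apply: DeriveDef.
        apply: diff_derivable; apply: linear_differentiable.
        exact: gradient_form_continuous.
      rewrite deriveE ?diff_lin//; first exact: gradient_form_continuous.
      apply: linear_differentiable; exact: gradient_form_continuous.
    split; first by apply: derivableB.
    rewrite /partial deriveB// derive_val.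
    rewrite [X in _ - X](_ : _ = partial i f x)//.
    rewrite /gradient_form (bigD1 i)//= big1 => [|j ji].
      by rewrite !mxE !eqxx mul1r addr0.
    by rewrite !mxE (negbTE ji) andbF mul0r.
  near=> h.
  rewrite !fctE /=.
  have -> : f (h + x) - (f x + gradient_form f x h) = g (h + x) - g x.
    by rewrite /g linearD/=; ring.
  apply: le_trans (glip x (h + x) _ _) _; first exact: ballxx.
    rewrite -ball_normE /= opprD addrCA subrr addr0 normrN.
    by near: h; apply/nbhs_ballP; exists r => // y; rewrite -ball_normE/= sub0r normrN.
  have -> : h + x - x = h by exact: addrK.
  rewrite ler_wpM2r// /e' mulrCA ger_pMr// ler_pdivrMr// mul1r.
  by rewrite lerDl.
have fd : 'd f x = gradient_form f x :> (_ -> _).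
  by apply: diff_unique => //; exact: gradient_form_continuous.
apply: DiffDef => //; apply/diff_locallyP; rewrite fd; split => //.
exact: gradient_form_continuous.
Unshelve. all: by end_near. Qed.

End C1Differentiable.

Section CkCalculus.
Context {R : realType}.
Local Notation e_ i := (delta_mx 0 i : 'rV[R]__).

Section Basics.
Context {n : nat}.
Implicit Types (U V : set 'rV[R]_n) (f g : 'rV[R]_n -> R) (k : nat).

Lemma Ck_continuous k U f x : Ck k U f -> U x -> {for x, continuous f}.
Proof. by case: k => [|k] [+ _]; apply. Qed.

Lemma CkSP k U f : Ck k.+1 U f -> forall i,
  (forall x, U x -> derivable f x (delta_mx 0 i)) /\ Ck k U (partial i f).
Proof. by case. Qed.

Lemma Ck_partial k U f i : Ck k.+1 U f -> Ck k U (partial i f).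
Proof. by move=> /CkSP/(_ i)[]. Qed.

Lemma Ck_derivable k U f i x : Ck k.+1 U f -> U x -> derivable f x (delta_mx 0 i).
Proof. by move=> /CkSP/(_ i)[+ _]; apply. Qed.

Lemma CkW k l U f : (l <= k)%N -> Ck k U f -> Ck l U f.
Proof.
elim: l k f => [|l IH] k f; first by case: k => [|k] _ [].
case: k => // k lk [cf df]; split=> // i; have [d1 d2] := df i.
by split=> //; exact: IH d2.
Qed.

(** The charts of the two manifolds only overlap locally; this is what glues the
    regularity obtained on the overlaps. *)
Lemma Ck_local k U f :
  (forall x, U x -> exists2 V, V x & Ck k V f) -> Ck k U f.
Proof.
elim: k f => [|k IH] f H.
  by split=> // x /H[V Vx fV]; exact: Ck_continuous fV Vx.
split=> [x /H[V Vx fV]|i]; first exact: Ck_continuous fV Vx.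
split=> [x /H[V Vx fV]|]; first exact: Ck_derivable fV Vx.
apply: IH => x /H[V Vx fV]; exists V => //; exact: Ck_partial.
Qed.

Lemma Ck_sub k U V f : V `<=` U -> Ck k U f -> Ck k V f.
Proof. by move=> VU fU; apply: Ck_local => x /VU Ux; exists U. Qed.

Lemma near_partial U f g i x : open U -> U x -> {in U, f =1 g} ->
  partial i f x = partial i g x.
Proof.
move=> oU Ux fg; apply: near_eq_derive.
by apply: filterS _ (open_nbhs_nbhs (conj oU Ux)) => y /mem_set/fg.
Qed.

Lemma Ck_ext k U f g : open U -> {in U, f =1 g} -> Ck k U f -> Ck k U g.
Proof.
move=> oU; elim: k f g => [|k IH] f g fg.
  move=> [fc _]; split=> // x Ux; have nfg : \forall y \near x, f y = g y.
    by apply: filterS _ (open_nbhs_nbhs (conj oU Ux)) => y /mem_set/fg.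
  rewrite /prop_for /continuous_at -(fg _ (mem_set Ux)).
  exact: cvg_trans (@near_eq_cvg _ _ (nbhs x) _ f g nfg) (fc _ Ux).
move=> Cf; split.
  by move=> x; exact: (Ck_continuous (IH f g fg (CkW (leqnSn k) Cf))).
move=> i; split.
  move=> x Ux; apply: (@near_eq_derivable _ _ _ f); last exact: Ck_derivable Cf Ux.
  by apply: filterS _ (open_nbhs_nbhs (conj oU Ux)) => y /mem_set/fg.
apply: IH _ (Ck_partial i Cf) => x /set_mem Ux; exact: near_partial Ux fg.
Qed.

Lemma Ck_is_diff k U f x : open U -> Ck k.+1 U f -> U x ->
  is_diff x f (gradient_form f x).
Proof.
move=> oU fU Ux; apply: is_diff_of_continuous_partials.
  apply: filterS _ (open_nbhs_nbhs (conj oU Ux)) => y Uy i.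
  exact: Ck_derivable fU Uy.
move=> i; exact: Ck_continuous (Ck_partial i fU) Ux.
Qed.

Lemma Ck_cst k U c : Ck k U (fun=> c).
Proof.
elim: k c => [|k IH] c; first by split=> // x _; exact: cst_continuous.
split=> [x _|i]; first exact: cst_continuous.
split=> [x _|]; first exact: derivable_cst.
suff -> : partial i (fun=> c) = (fun=> 0 : R) by exact: IH.
by apply/funext => x; exact: derive_cst.
Qed.

(** Differentiation rules give a formula for the partial derivatives on U only,
    so the induction on k needs the formula df rather than [partial i f]. *)
Lemma CkS_intro k U f (df : 'I_n -> 'rV[R]_n -> R) : open U ->
  (forall x i, U x -> is_derive x (delta_mx 0 i) f (df i x)) ->
  Ck 0 U f -> (forall i, Ck k U (df i)) -> Ck k.+1 U f.
Proof.
move=> oU fd [fc _] dfU; split=> // i; split=> [x /(fd x i)[]//|].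
by apply: Ck_ext (dfU i) => // x /set_mem/(fd x i)[_].
Qed.

Lemma Ck_is_derive k U f i x : Ck k.+1 U f -> U x ->
  is_derive x (delta_mx 0 i) f (partial i f x).
Proof. by move=> fU Ux; apply/derivableP; exact: Ck_derivable fU Ux. Qed.

Lemma Ck_add k U f g : open U -> Ck k U f -> Ck k U g -> Ck k U (fun x => f x + g x).
Proof.
move=> oU; elim: k f g => [|k IH] f g fU gU.
  split=> // x Ux; apply: continuous_at_add;
    [exact: Ck_continuous fU Ux|exact: Ck_continuous gU Ux].
apply: (@CkS_intro _ _ _ (fun i x => partial i f x + partial i g x)) => //.
- by move=> x i Ux; apply: is_derive_add; [exact: Ck_is_derive fU Ux|exact: Ck_is_derive gU Ux].
- have := IH _ _ (CkW (leqnSn k) fU) (CkW (leqnSn k) gU); exact: CkW.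
- by move=> i; apply: IH; exact: Ck_partial.
Qed.

Lemma Ck_mul k U f g : open U -> Ck k U f -> Ck k U g -> Ck k U (fun x => f x * g x).
Proof.
move=> oU; elim: k f g => [|k IH] f g fU gU.
  split=> // x Ux; apply: continuous_at_mul;
    [exact: Ck_continuous fU Ux|exact: Ck_continuous gU Ux].
have fW := CkW (leqnSn k) fU; have gW := CkW (leqnSn k) gU.
apply: (@CkS_intro _ _ _ (fun i x => partial i f x * g x + f x * partial i g x)) => //.
- by move=> x i Ux; apply: is_derive_mul; [exact: Ck_is_derive fU Ux|exact: Ck_is_derive gU Ux].
- have := IH _ _ fW gW; exact: CkW.
- by move=> i; apply: Ck_add => //; apply: IH => //; exact: Ck_partial.
Qed.

Lemma Ck_opp k U f : open U -> Ck k U f -> Ck k U (fun x => - f x).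
Proof.
move=> oU fU; have := Ck_mul oU (Ck_cst k U (-1)) fU.
by apply: Ck_ext => // x _; rewrite mulN1r.
Qed.

Lemma Ck_sub_fun k U f g : open U -> Ck k U f -> Ck k U g -> Ck k U (fun x => f x - g x).
Proof. by move=> oU fU gU; apply: Ck_add => //; exact: Ck_opp. Qed.

Lemma is_derive_coord i x v : is_derive x v (fun y : 'rV[R]_n => y 0 i) (v 0 i).
Proof.
have did : derivable (@id 'rV[R]_n) x v by exact: derivable_id.
have dc : derivable (fun y : 'rV[R]_n => y 0 i) x v by move/derivable_mxP: did.
apply: DeriveDef => //.
by have := derive_id x v; rewrite derive_mx// => /rowP/(_ i); rewrite mxE.
Qed.

Lemma Ck_coord k U i : open U -> Ck k U (fun y => y 0 i).
Proof.
have c0 : Ck 0 U (fun y => y 0 i) by split=> // x _; exact: coord_continuous.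
case: k => // k oU; apply: (@CkS_intro _ _ _ (fun j _ => (delta_mx 0 j : 'rV_n) 0 i)) => //.
  by move=> x j _; exact: is_derive_coord.
by move=> j; exact: Ck_cst.
Qed.

Lemma Ck_sum (I : Type) (r : seq I) (P : pred I) k U (F : I -> 'rV[R]_n -> R) :
  open U -> (forall i, Ck k U (F i)) -> Ck k U (fun x => \sum_(i <- r | P i) F i x).
Proof.
move=> oU FU; elim: r => [|i r IH].
  by apply: Ck_ext (Ck_cst k U 0) => // x _; rewrite big_nil.
case: (boolP (P i)) => Pi.
  by apply: Ck_ext (Ck_add oU (FU i) IH) => // x _; rewrite big_cons Pi.
by apply: Ck_ext IH => // x _; rewrite big_cons (negbTE Pi).
Qed.

Lemma Ck_prod (I : Type) (r : seq I) (P : pred I) k U (F : I -> 'rV[R]_n -> R) :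
  open U -> (forall i, Ck k U (F i)) -> Ck k U (fun x => \prod_(i <- r | P i) F i x).
Proof.
move=> oU FU; elim: r => [|i r IH].
  by apply: Ck_ext (Ck_cst k U 1) => // x _; rewrite big_nil.
case: (boolP (P i)) => Pi.
  by apply: Ck_ext (Ck_mul oU (FU i) IH) => // x _; rewrite big_cons Pi.
by apply: Ck_ext IH => // x _; rewrite big_cons (negbTE Pi).
Qed.

Lemma Ck_inv k U f : open U -> (forall x, U x -> f x != 0) ->
  Ck k U f -> Ck k U (fun x => (f x)^-1).
Proof.
move=> oU f0; elim: k => [|k IH] fU.
  by split=> // x Ux; apply: continuousV; [exact: f0|exact: Ck_continuous fU Ux].
have IHW := IH (CkW (leqnSn k) fU).
apply: (@CkS_intro _ _ _ (fun i x => - (f x)^-1 ^+ 2 * partial i f x)) => //.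
- by move=> x i Ux; apply: is_derive_inv; [exact: f0|exact: Ck_is_derive fU Ux].
- exact: CkW IHW.
- move=> i; apply: Ck_mul => //; last exact: Ck_partial.
  by apply: Ck_opp => //; exact: Ck_mul.
Qed.

End Basics.

Lemma continuous_Ckmap n m k (U : set 'rV[R]_n) (h : 'rV[R]_n -> 'rV[R]_m) x :
  Ckmap k U h -> U x -> {for x, continuous h}.
Proof.
by move=> hU Ux; apply: continuous_rV_coord => j; exact: Ck_continuous (hU j) Ux.
Qed.

Lemma CkmapW n m k l (U : set 'rV[R]_n) (h : 'rV[R]_n -> 'rV[R]_m) :
  (l <= k)%N -> Ckmap k U h -> Ckmap l U h.
Proof. by move=> lk hU j; exact: CkW (hU j). Qed.

Lemma is_derive_rV (V : normedModType R) m (h : V -> 'rV[R]_m) x v (d : 'rV[R]_m) :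
  (forall j, is_derive x v (fun y => h y 0 j) (d 0 j)) -> is_derive x v h d.
Proof.
move=> hd; have hv : derivable h x v.
  by apply/derivable_mxP => i j; rewrite ord1; have [] := hd j.
apply: DeriveDef => //; rewrite derive_mx//; apply/rowP => j; rewrite !mxE.
by have [_ ->] := hd j.
Qed.

(** Only the directional derivative of h along v is needed: on the line through x
    directed by v, h becomes a differentiable function of one variable.  This
    covers both curves (V = R) and partial derivatives. *)
Lemma is_derive_comp_C1 (V : normedModType R) m k (W : set 'rV[R]_m)
    (f : 'rV[R]_m -> R) (h : V -> 'rV[R]_m) x v (d : 'rV[R]_m) :
  open W -> Ck k.+1 W f -> W (h x) ->
  (forall j, is_derive x v (fun y => h y 0 j) (d 0 j)) ->
  is_derive x v (f \o h) (\sum_j d 0 j * partial j f (h x)).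
Proof.
move=> oW fW Wx hd.
have hd' j : is_derive (0 : R) (1 : R) (fun t : R => h (x + t *: v) 0 j) (d 0 j).
  have [h1 h2] := hd j; apply: DeriveDef.
    exact/(derivable_line0 (fun y => h y 0 j)).
  by rewrite (derive_line0 (fun y => h y 0 j)).
pose c (t : R) := h (x + t *: v).
have dc : derivable c 0 1.
  by apply/derivable_mxP => i j; rewrite ord1; have [] := hd' j.
have c0 : c 0 = h x by rewrite /c scale0r addr0.
have dcE : 'D_1 c 0 = d.
  by rewrite derive_mx//; apply/rowP => j; rewrite !mxE; have [_ ->] := hd' j.
have [fd fv] : is_diff (c 0) f (gradient_form f (c 0)).
  by rewrite c0; exact: Ck_is_diff oW fW Wx.
have dc' : differentiable c 0 by apply/derivable1_diffP.
have dfc : differentiable (f \o c) 0 by apply: differentiable_comp.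
have d1 : derivable (f \o c) 0 1 by apply/derivable1_diffP.
apply: DeriveDef.
  exact: ((derivable_line0 (f \o h) x v).1 d1).
rewrite -(derive_line0 (f \o h)) -/(f \o c) deriveE// diff_comp//= fv.
by rewrite /gradient_form -deriveE// dcE c0.
Qed.

Lemma partial_comp n m k (U : set 'rV[R]_n) (W : set 'rV[R]_m)
    (f : 'rV[R]_m -> R) (h : 'rV[R]_n -> 'rV[R]_m) i x :
  open W -> Ck k.+1 W f -> W (h x) -> Ckmap k.+1 U h -> U x ->
  is_derive x (delta_mx 0 i) (f \o h)
    (\sum_j partial i (fun y => h y 0 j) x * partial j f (h x)).
Proof.
move=> oW fW Wx hU Ux.
pose d : 'rV[R]_m := \row_j partial i (fun y => h y 0 j) x.
have -> : \sum_j partial i (fun y => h y 0 j) x * partial j f (h x) =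
  \sum_j d 0 j * partial j f (h x) by apply: eq_bigr => j _; rewrite mxE.
apply: is_derive_comp_C1 oW fW Wx _ => j; rewrite mxE; apply/derivableP.
exact: Ck_derivable (hU j) Ux.
Qed.

Lemma Ck_comp n m k (U : set 'rV[R]_n) (W : set 'rV[R]_m)
    (f : 'rV[R]_m -> R) (h : 'rV[R]_n -> 'rV[R]_m) :
  open U -> open W -> (forall x, U x -> W (h x)) ->
  Ckmap k U h -> Ck k W f -> Ck k U (f \o h).
Proof.
move=> oU oW hUW; elim: k f => [|k IH] f hU fW.
  split=> // x Ux; apply: continuous_comp; first exact: continuous_Ckmap hU Ux.
  exact: Ck_continuous fW (hUW _ Ux).
split=> [x Ux|i].
  apply: continuous_comp; first exact: continuous_Ckmap hU Ux.
  exact: Ck_continuous fW (hUW _ Ux).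
have hd x : U x -> _ := fun Ux => partial_comp i oW fW (hUW x Ux) hU Ux.
split=> [x /hd[]//|].
apply: (@Ck_ext _ _ _ (fun x => \sum_j partial i (fun y => h y 0 j) x * partial j f (h x))) => //.
  by move=> x /set_mem/hd[_ e]; rewrite /partial e.
apply: Ck_sum => // j; apply: Ck_mul => //; first exact: Ck_partial (hU j).
by apply: IH (Ck_partial j fW); exact: CkmapW (leqnSn k) hU.
Qed.

End CkCalculus.

(** * Matrix-valued functions and mixed derivatives *)

Section MatrixFields.
Context {R : realType} {n : nat}.
Implicit Types (U : set 'rV[R]_n) (k : nat).

Definition Ckmx p q k U (F : 'rV[R]_n -> 'M[R]_(p, q)) :=
  forall i j, Ck k U (fun x => F x i j).

Definition dmx p q (i : 'I_n) (F : 'rV[R]_n -> 'M[R]_(p, q)) (x : 'rV[R]_n) :=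
  \matrix_(a, b) partial i (fun y => F y a b) x.

Lemma dmx_entry p q i (F : 'rV[R]_n -> 'M[R]_(p, q)) x a b :
  dmx i F x a b = partial i (fun y => F y a b) x.
Proof. by rewrite mxE. Qed.

Lemma CkmxW p q k l U (F : 'rV[R]_n -> 'M[R]_(p, q)) :
  (l <= k)%N -> Ckmx k U F -> Ckmx l U F.
Proof. by move=> lk FU i j; exact: CkW lk (FU i j). Qed.

Lemma Ckmx_ext p q k U (F H : 'rV[R]_n -> 'M[R]_(p, q)) :
  open U -> (forall x, U x -> F x = H x) -> Ckmx k U F -> Ckmx k U H.
Proof.
by move=> oU FH FU i j; apply: Ck_ext (FU i j) => // x /set_mem/FH ->.
Qed.

Lemma Ckmx_tr p q k U (F : 'rV[R]_n -> 'M[R]_(p, q)) :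
  open U -> Ckmx k U F -> Ckmx k U (fun x => (F x)^T).
Proof. by move=> oU FU i j; apply: Ck_ext (FU j i) => // x _; rewrite mxE. Qed.

Lemma Ckmx_mul p q s k U (F : 'rV[R]_n -> 'M[R]_(p, q)) (H : 'rV[R]_n -> 'M[R]_(q, s)) :
  open U -> Ckmx k U F -> Ckmx k U H -> Ckmx k U (fun x => F x *m H x).
Proof.
move=> oU FU HU i j.
apply: (@Ck_ext _ _ _ _ (fun x => \sum_l F x i l * H x l j)) => //.
  by move=> x _; rewrite mxE.
by apply: Ck_sum => // l; exact: Ck_mul.
Qed.

Lemma Ck_det p k U (F : 'rV[R]_n -> 'M[R]_p) :
  open U -> Ckmx k U F -> Ck k U (fun x => \det (F x)).
Proof.
move=> oU FU; apply: Ck_sum => // s; apply: Ck_mul => //; first exact: Ck_cst.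
by apply: Ck_prod => // i; exact: FU.
Qed.

Lemma Ckmx_inv p k U (F : 'rV[R]_n -> 'M[R]_p) :
  open U -> (forall x, U x -> F x \in unitmx) ->
  Ckmx k U F -> Ckmx k U (fun x => invmx (F x)).
Proof.
move=> oU F1 FU i j.
apply: (@Ck_ext _ _ _ _ (fun x => (\det (F x))^-1 * cofactor (F x) j i)) => //.
  by move=> x /set_mem/F1 Fx; rewrite /invmx Fx !mxE.
apply: Ck_mul => //.
  apply: Ck_inv => //; last exact: Ck_det.
  by move=> x /F1; rewrite unitmxE unitfE.
apply: Ck_mul => //; first exact: Ck_cst.
apply: Ck_det => // a b; apply: Ck_ext (FU (lift j a) (lift i b)) => // x _.
by rewrite !mxE.
Qed.

Lemma Ckmx_dmx p q k U i (F : 'rV[R]_n -> 'M[R]_(p, q)) :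
  open U -> Ckmx k.+1 U F -> Ckmx k U (dmx i F).
Proof.
move=> oU FU a b; apply: Ck_ext (Ck_partial i (FU a b)) => // x _.
by rewrite mxE.
Qed.

Lemma is_derive_Ckmx p q k U i (F : 'rV[R]_n -> 'M[R]_(p, q)) x a b :
  Ckmx k.+1 U F -> U x ->
  is_derive x (delta_mx 0 i : 'rV[R]_n) (fun y => F y a b) (dmx i F x a b).
Proof. by move=> FU Ux; rewrite mxE; exact: Ck_is_derive (FU a b) Ux. Qed.

Lemma dmxE p q i (F : 'rV[R]_n -> 'M[R]_(p, q)) x (D : 'M[R]_(p, q)) :
  (forall a b, is_derive x (delta_mx 0 i : 'rV[R]_n) (fun y => F y a b) (D a b)) ->
  dmx i F x = D.
Proof. by move=> FD; apply/matrixP => a b; rewrite mxE; exact: partialE. Qed.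

Lemma dmx_ext p q i U (F H : 'rV[R]_n -> 'M[R]_(p, q)) x :
  open U -> (forall y, U y -> F y = H y) -> U x -> dmx i F x = dmx i H x.
Proof.
move=> oU FH Ux; apply/matrixP => a b; rewrite !mxE.
by apply: near_partial oU Ux _ => y /set_mem/FH ->.
Qed.

Lemma dmx_tr p q i (F : 'rV[R]_n -> 'M[R]_(p, q)) x :
  dmx i (fun y => (F y)^T) x = (dmx i F x)^T.
Proof. by apply/matrixP => a b; rewrite !mxE; under eq_fun do rewrite mxE. Qed.

Lemma dmx_mul p q s k l U i (F : 'rV[R]_n -> 'M[R]_(p, q)) (H : 'rV[R]_n -> 'M[R]_(q, s)) x :
  Ckmx k.+1 U F -> Ckmx l.+1 U H -> U x ->
  dmx i (fun y => F y *m H y) x = dmx i F x *m H x + F x *m dmx i H x.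
Proof.
move=> FU HU Ux; apply: dmxE => a b; rewrite !mxE -big_split/=.
under eq_fun do rewrite mxE.
apply: is_derive_bigsum => c; apply: is_derive_mul; exact: is_derive_Ckmx Ux.
Qed.

Lemma dmx_cst p q i (A : 'M[R]_(p, q)) x : dmx i (fun=> A) x = 0.
Proof. by apply: dmxE => a b; rewrite mxE; exact: is_derive_cst. Qed.

(** Differentiate [invmx (F y) *m F y = 1%:M]. *)
Lemma dmx_inv p k U i (F : 'rV[R]_n -> 'M[R]_p) x :
  open U -> (forall y, U y -> F y \in unitmx) -> Ckmx k.+1 U F -> U x ->
  dmx i (fun y => invmx (F y)) x = - (invmx (F x) *m dmx i F x *m invmx (F x)).
Proof.
move=> oU F1 FU Ux; have iU := Ckmx_inv oU F1 FU.
have := dmx_mul i iU FU Ux.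
rewrite (@dmx_ext _ _ i U _ (fun=> 1%:M))//; last by move=> y /F1 Fy; rewrite mulVmx.
rewrite dmx_cst => /esym/eqP; rewrite addr_eq0 => /eqP/(congr1 (mulmx^~ (invmx (F x))))/=.
by rewrite mulmxK ?F1// mulNmx.
Qed.

End MatrixFields.

Section Schwarz.
Context {R : realType} {n : nat}.
Local Notation e_ i := (delta_mx 0 i : 'rV[R]_n).

(** Schwarz's theorem with an assumption on one mixed derivative only: the
    existence of the other one is part of the conclusion.  This asymmetry is the
    source of the gain of regularity below.  The second-order difference quotient
    is within eps of A by two mean value estimates, the outer one along e_ i and
    the inner one along e_ j; letting the increment along e_ j tend to 0 first
    leaves the difference quotient of [partial j f] along e_ i. *)
Lemma partial_swap (U : set 'rV[R]_n) (f : 'rV[R]_n -> R) i j x :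
  open U -> U x ->
  (forall y, U y -> derivable f y (e_ i)) ->
  (forall y, U y -> derivable f y (e_ j)) ->
  (forall y, U y -> derivable (partial i f) y (e_ j)) ->
  {for x, continuous (partial j (partial i f))} ->
  is_derive x (e_ i) (partial j f) (partial j (partial i f) x).
Proof.
move=> oU Ux fi fj fij cij; set A := partial j (partial i f) x.
have ke l (t : R) : `|t *: e_ l| <= `|t|.
  rewrite normrZ -[leRHS]mulr1 ler_wpM2l// row_norm_le// => m.
  by rewrite mxE; case: (_ && _); rewrite ?normr1 ?normr0.
have key (eps : R) : 0 < eps -> exists2 r : R, 0 < r & forall h k : R,
    `|h| < r -> `|k| < r ->
    U (x + h *: e_ i) /\
    `|(f (x + h *: e_ i + k *: e_ j) - f (x + h *: e_ i)) -
      (f (x + k *: e_ j) - f x) - h * k * A| <= eps * `|h| * `|k|.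
  move=> eps0.
  have /nbhs_ballP[r/= r0 rP] : \forall y \near x,
      U y /\ `|partial j (partial i f) y - A| <= eps.
    have /cvgrPdist_le/(_ _ eps0) H := cij.
    have H' := open_nbhs_nbhs (conj oU Ux).
    near=> y; split; first by near: y.
    by rewrite distrC; near: y.
  have inb (h k : R) : `|h| < r / 2 -> `|k| < r / 2 -> ball x r (x + h *: e_ i + k *: e_ j).
    move=> hr kr; rewrite -ball_normE/= -addrA opprD addrA subrr sub0r normrN.
    apply: le_lt_trans (ler_normD _ _) _; rewrite [ltRHS]splitr ltrD//.
      exact: le_lt_trans (ke _ _) hr.
    exact: le_lt_trans (ke _ _) kr.
  have small (h t : R) : `|h| < r / 2 -> Num.min 0 h <= t <= Num.max 0 h -> `|t| < r / 2.
    move: (r / 2) => q; rewrite !ltr_norml => /andP[? ?].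
    by rewrite ge_min le_max => /andP[/orP[]? /orP[]?]; apply/andP; split; lra.
  exists (r / 2); first by rewrite divr_gt0.
  move=> h k hr kr; split.
    have := inb h 0 hr; rewrite scale0r addr0 normr0 => /(_ _)/rP[]//.
    by rewrite divr_gt0.
  have r2 : 0 < r / 2 by rewrite divr_gt0.
  have Uline (t : R) : `|t| < r / 2 -> U (x + t *: e_ i + k *: e_ j).
    by move=> tr; have [] := rP _ (inb t k tr kr).
  have Uline0 (t : R) : `|t| < r / 2 -> U (x + t *: e_ i).
    move=> tr; have := inb t 0 tr; rewrite scale0r addr0 normr0 => /(_ r2)/rP[]//.
  pose u t := f (x + t *: e_ i + k *: e_ j) - f (x + t *: e_ i) - t * (k * A).
  have ud t : `|t| < r / 2 -> is_derive t (1 : R) u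
     (partial i f (x + t *: e_ i + k *: e_ j) - partial i f (x + t *: e_ i) - k * A).
    move=> tr; apply: is_derive_sub; first apply: is_derive_sub.
    - under eq_fun do rewrite addrAC.
      apply: DeriveDef; first by apply/(derivable_line f); rewrite addrAC; apply/fi/Uline.
      by rewrite (derive_line f) addrAC.
    - apply: DeriveDef; first by apply/(derivable_line f); apply/fi/Uline0.
      by rewrite (derive_line f).
    - exact: is_derive_scale.
  have -> : (f (x + h *: e_ i + k *: e_ j) - f (x + h *: e_ i)) -
      (f (x + k *: e_ j) - f x) - h * k * A = u h - u 0.
    by rewrite /u scale0r addr0; ring.
  rewrite -mulrA (mulrC `|h|) mulrA -[h in leRHS]subr0.
  apply: bounded_derivative_lipschitz => t /(small _ _ hr) tr.
  have [d ->] := ud t tr; split=> //.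
  pose w s := partial i f (x + t *: e_ i + s *: e_ j) - s * A.
  have wd s : `|s| < r / 2 -> is_derive s (1 : R) w
     (partial j (partial i f) (x + t *: e_ i + s *: e_ j) - A).
    move=> sr; apply: is_derive_sub.
      apply: DeriveDef; last by rewrite (derive_line (partial i f)).
      by apply/(derivable_line (partial i f)); have [/fij] := rP _ (inb t s tr sr).
    exact: is_derive_scale.
  have -> : partial i f (x + t *: e_ i + k *: e_ j) - partial i f (x + t *: e_ i) - k * A
     = w k - w 0 by rewrite /w scale0r addr0; ring.
  rewrite -[k in leRHS]subr0; apply: bounded_derivative_lipschitz => s /(small _ _ kr) sr.
  have [dw ->] := wd s sr; split => //.
  by have [_] := rP _ (inb t s tr sr).
apply: is_derive_of_bound => eps eps0; have [r r0 rP] := key _ eps0.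
exists r => // h hr; have [] := rP h 0 hr; rewrite normr0 => // Uh _.
pose g k := (f (x + h *: e_ i + k *: e_ j) - f (x + h *: e_ i)) -
            (f (x + k *: e_ j) - f x) - k * (h * A).
apply: (derivative_bound (g := g) r0).
  have dline y : U y -> is_derive (0 : R) (1 : R) (fun k : R => f (y + k *: e_ j)) (partial j f y).
    move=> Uy; apply: DeriveDef; first by apply/(derivable_line0 f); exact: fj.
    by rewrite (derive_line0 f).
  apply: is_derive_sub; last exact: is_derive_scale.
  have dC c y : U y ->
      is_derive (0 : R) (1 : R) (fun k : R => f (y + k *: e_ j) - c) (partial j f y).
    by move=> Uy; rewrite -[partial j f y]subr0; apply: is_derive_sub; exact: dline.
  by apply: is_derive_sub; exact: dC.
move=> k kr; have [_] := rP h k hr kr; congr (`|_| <= _).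
by rewrite /g !scale0r !addr0; ring.
Unshelve. all: by end_near. Qed.


End Schwarz.

(** * Regularity of solutions of the Levi-Civita equations *)

#[local] Opaque Ck partial dmx.

Section Christoffel.
Context {R : realType} {n : nat}.
Implicit Types (U : set 'rV[R]_n) (k : nat) (G : 'rV[R]_n -> 'M[R]_n).

Definition christoffel_mx G (i : 'I_n) (x : 'rV[R]_n) : 'M[R]_n :=
  \matrix_(l, j) christoffel G l i j x.

Lemma Ckmx_christoffel k U G i : open U -> (forall x, U x -> G x \in unitmx) ->
  Ckmx k.+1 U G -> Ckmx k U (christoffel_mx G i).
Proof.
move=> oU G1 GU l j.
apply: (@Ck_ext _ _ _ _ (christoffel G l i j) _ oU); first by move=> x _; rewrite mxE.
have dG a b c : Ck k U (partial a (fun y => G y b c)) by exact: Ck_partial (GU b c).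
apply: (Ck_mul oU); first exact: Ck_cst.
apply: (Ck_sum _ _ oU) => m; apply: (Ck_mul oU).
  by apply: (Ckmx_inv oU G1 _ l m); exact: CkmxW GU.
by apply: (Ck_add oU); [exact: (Ck_add oU)|exact: (Ck_opp oU)].
Qed.

Lemma dmx_sym U G i x : open U -> (forall y, U y -> (G y)^T = G y) -> U x ->
  (dmx i G x)^T = dmx i G x.
Proof. by move=> oU Gs Ux; rewrite -dmx_tr; exact: dmx_ext oU Gs Ux. Qed.

Lemma mul_christoffel_mx G i x : G x \in unitmx ->
  G x *m christoffel_mx G i x =
  2^-1 *: \matrix_(l, j) (dmx i G x j l + dmx j G x i l - dmx l G x i j).
Proof.
move=> G1; have -> : christoffel_mx G i x =
  2^-1 *: (invmx (G x) *m \matrix_(l, j) (dmx i G x j l + dmx j G x i l - dmx l G x i j)).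
  apply/matrixP => l j; rewrite mxE [RHS]mxE [in RHS]mxE; congr (_ * _).
  apply: eq_bigr => m _; congr (_ * _); symmetry; rewrite mxE.
  rewrite !dmx_entry. done.
by rewrite -scalemxAr mulKVmx.
Qed.

Lemma christoffel_sym U G l i j x : open U ->
  (forall y, U y -> (G y)^T = G y) -> U x -> christoffel G l i j x = christoffel G l j i x.
Proof.
move=> oU Gs Ux; rewrite /christoffel; congr (_ * _); apply: eq_bigr => m _.
congr (_ * _); rewrite [X in _ - X = _](_ : _ = partial m (fun y => G y j i) x).
  by rewrite [X in X - _ = _]addrC.
by apply: near_partial oU Ux _ => y /set_mem/Gs {1}<-; rewrite mxE.
Qed.

#[local] Opaque christoffel.

Lemma metric_compatibility U G i x : open U -> (forall y, U y -> (G y)^T = G y) ->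
  U x -> G x \in unitmx ->
  dmx i G x = (christoffel_mx G i x)^T *m G x + G x *m christoffel_mx G i x.
Proof.
move=> oU Gs Ux G1; rewrite -{1}(Gs _ Ux) -trmx_mul mul_christoffel_mx//.
have ds m a b : dmx m G x a b = dmx m G x b a.
  by rewrite -{1}(dmx_sym m oU Gs Ux) [LHS]mxE.
suff alg (D : 'I_n -> 'M[R]_n) : (forall m a b, D m a b = D m b a) ->
    D i = (2^-1 *: \matrix_(l, j) (D i j l + D j i l - D l i j))^T +
          2^-1 *: \matrix_(l, j) (D i j l + D j i l - D l i j).
  exact: (alg (fun m => dmx m G x)).
move=> Ds; apply/matrixP => a b.
by rewrite !mxE (Ds i b a); field.
Qed.

Lemma trace_christoffel U G i x : open U -> (forall y, U y -> (G y)^T = G y) ->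
  U x -> G x \in unitmx ->
  \tr (christoffel_mx G i x) = 2^-1 * \tr (invmx (G x) *m dmx i G x).
Proof.
move=> oU Gs Ux G1; rewrite (metric_compatibility i oU Gs Ux G1) mulmxDr mxtraceD.
rewrite mulKmx// mxtrace_mulC mulmxK// mxtrace_tr; by field.
Qed.

(** The Hessian of log |det G|; its gradient is the trace of
    [invmx (G x) *m dmx j G x], twice a contracted Christoffel symbol. *)
Definition dlog2 G (i j : 'I_n) x : R :=
  \tr (invmx (G x) *m dmx i (dmx j G) x) -
  \tr (invmx (G x) *m dmx i G x *m (invmx (G x) *m dmx j G x)).

Lemma partial_trace_log_derivative U G i j x : open U ->
  (forall y, U y -> G y \in unitmx) -> Ckmx 2 U G -> U x ->
  is_derive x (delta_mx 0 i : 'rV[R]_n) (fun y => \tr (invmx (G y) *m dmx j G y))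
   (dlog2 G i j x).
Proof.
move=> oU G1 GU Ux.
have iU : Ckmx 2 U (fun y => invmx (G y)) by exact: Ckmx_inv.
have dU : Ckmx 1 U (dmx j G) by exact: Ckmx_dmx.
have iU1 : Ckmx 1 U (fun y => invmx (G y)) by exact: CkmxW iU.
have pU : Ckmx 1 U (fun y => invmx (G y) *m dmx j G y) by exact: Ckmx_mul.
have -> : dlog2 G i j x = \tr (dmx i (fun y => invmx (G y) *m dmx j G y) x).
  rewrite (dmx_mul i iU dU Ux) (dmx_inv i oU G1 GU Ux) mxtraceD addrC /dlog2.
  by rewrite !mulNmx raddfN/= !mulmxA.
by apply: is_derive_bigsum => a; exact: is_derive_Ckmx pU Ux.
Qed.

Lemma dmx_swap U p q (F : 'rV[R]_n -> 'M[R]_(p, q)) i j x : open U -> Ckmx 2 U F -> U x ->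
  dmx i (dmx j F) x = dmx j (dmx i F) x.
Proof.
move=> oU FU Ux; apply/matrixP => a b; rewrite [LHS]dmx_entry [RHS]dmx_entry.
have h i' j' : partial i' (fun y => dmx j' F y a b) x =
    partial i' (partial j' (fun y => F y a b)) x.
  suff -> : (fun y => dmx j' F y a b) = partial j' (fun y => F y a b) by [].
  by apply/funext => y; rewrite dmx_entry.
rewrite !h; symmetry; apply: partialE.
apply: (@partial_swap _ _ U) => //.
- by move=> y Uy; exact: Ck_derivable (FU a b) Uy.
- by move=> y Uy; exact: Ck_derivable (FU a b) Uy.
- by move=> y Uy; apply: Ck_derivable (Ck_partial _ (FU a b)) Uy.
- exact: Ck_continuous (Ck_partial _ (Ck_partial _ (FU a b))) Ux.
Qed.

Lemma dlog2_sym U G i j x : open U -> Ckmx 2 U G -> U x ->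
  dlog2 G i j x = dlog2 G j i x.
Proof.
move=> oU GU Ux; rewrite /dlog2 (dmx_swap i j oU GU Ux).
have trC (A B : 'M[R]_n) : \tr (A *m B) = \tr (B *m A) := mxtrace_mulC A B.
by rewrite [X in _ - X = _]trC.
Qed.

End Christoffel.

Section Regularity.
Context {R : realType} {n : nat}.
Local Notation e_ i := (delta_mx 0 i : 'rV[R]_n).

Lemma one_form_trace (P : 'I_n -> 'I_n -> 'I_n -> R) (psi : 'I_n -> R) :
  (forall k i j, P k i j = (k == i)%:R * psi j + (k == j)%:R * psi i) ->
  forall j, \sum_l P l j l = n.+1%:R * psi j.
Proof.
move=> Ppsi j; under eq_bigr do rewrite Ppsi eqxx mul1r.
rewrite big_split/= sumr_const card_ord (bigD1 j)//= eqxx mul1r big1.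
  by rewrite addr0 -[n.+1]add1n natrD mulrDl mul1r mulr_natl.
by move=> l /negbTE ->; rewrite mul0r.
Qed.

(** The hypotheses control all first derivatives of the vector field lam up to a
    common multiple of the identity matrix.  For m <> k, [partial m (lam k)] is
    regular, so [partial_swap] provides the derivative of [partial k (lam k)] along
    m.  Its derivative along k is reached through another index l: up to a regular
    function [partial k (lam k)] is [partial l (lam l)], whose derivative along k
    is again provided by [partial_swap].  This is where n >= 2 is needed. *)
Lemma Ck_gain_diagonal s (U : set 'rV[R]_n) (lam : 'I_n -> 'rV[R]_n -> R) :
  (1 < n)%N -> open U ->
  (forall i, Ck s.+1 U (lam i)) ->
  (forall m k, m != k -> Ck s.+1 U (partial m (lam k))) ->
  (forall m k, m != k -> Ck s.+1 U (fun x => partial m (lam m) x - partial k (lam k) x)) ->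
  forall i, Ck s.+2 U (lam i).
Proof.
move=> n1 oU lamU off dif k.
have swap m l x : m != l -> U x ->
    is_derive x (e_ m) (partial l (lam l)) (partial l (partial m (lam l)) x).
  move=> ml Ux; apply: (@partial_swap _ _ U) => //.
  - by move=> y Uy; exact: Ck_derivable (lamU l) Uy.
  - by move=> y Uy; exact: Ck_derivable (lamU l) Uy.
  - by move=> y Uy; exact: Ck_derivable (off _ _ ml) Uy.
  - exact: Ck_continuous (Ck_partial _ (off _ _ ml)) Ux.
have [l lk] : exists l : 'I_n, l != k.
  have [k0|k0] := eqVneq (k : nat) 0%N.
    by exists (Ordinal n1); rewrite -val_eqE /= k0.
  have n0 : (0 < n)%N by exact: ltnW.
  by exists (Ordinal n0); rewrite -val_eqE /= eq_sym.
have diag : Ck s.+1 U (partial k (lam k)).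
  pose D x := partial k (lam k) x - partial l (lam l) x.
  have DU : Ck s.+1 U D by apply: dif; rewrite eq_sym.
  apply: (@CkS_intro _ _ _ _ _ (fun m x => if m == k then
     partial l (partial k (lam l)) x + partial k D x
     else partial k (partial m (lam k)) x) oU).
  - move=> x m Ux; case: eqVneq => [->|mk]; last exact: swap.
    have -> : partial k (lam k) = (fun y => partial l (lam l) y + D y).
      by apply/funext => y; rewrite /D subrKC.
    apply: is_derive_add; last exact: Ck_is_derive DU Ux.
    by apply: swap => //; rewrite eq_sym.
  - by apply: CkW (Ck_partial k (lamU k)).
  - move=> m; case: eqVneq => mk; last exact: Ck_partial (off _ _ mk).
    apply: (Ck_add oU); last exact: Ck_partial.
    by apply: Ck_partial; apply: off; rewrite eq_sym.
apply: (@CkS_intro _ _ _ _ _ (fun m => partial m (lam k)) oU).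
- by move=> x m Ux; exact: Ck_is_derive (lamU k) Ux.
- exact: CkW (lamU k).
move=> m; by have [->|mk] := eqVneq m k; [exact: diag|exact: off].
Qed.

Section LeviCivita.
Variables (r : nat) (U : set 'rV[R]_n) (G Gb : 'rV[R]_n -> 'M[R]_n).
Hypotheses (n1 : (1 < n)%N) (r2 : (2 < r)%N) (oU : open U).
Hypotheses (GU : Ckmx r U G) (GbU : Ckmx 2 U Gb).
Hypotheses (Gs : forall x, U x -> (G x)^T = G x) (Gbs : forall x, U x -> (Gb x)^T = Gb x).
Hypotheses (G1 : forall x, U x -> G x \in unitmx) (Gb1 : forall x, U x -> Gb x \in unitmx).
Hypothesis levi_civita : forall x, U x -> exists psi : 'I_n -> R, forall k i j,
  christoffel Gb k i j x - christoffel G k i j x =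
  (k == i)%:R * psi j + (k == j)%:R * psi i.

(** psi is the one-form of the Levi-Civita equations, recovered by taking traces;
   b is the contravariant target metric, lam the vector field - psi^i, and S
   collects the terms of the covariant derivative of b with respect to G that
   contain Christoffel symbols. *)
Let psi (j : 'I_n) x : R :=
  n.+1%:R^-1 * (\tr (christoffel_mx Gb j x) - \tr (christoffel_mx G j x)).
Let b x := invmx (Gb x).
Let lam (j : 'I_n) x : R := - \sum_l psi l x * b x l j.
Let S (k : 'I_n) x := christoffel_mx G k x *m b x + (christoffel_mx G k x *m b x)^T.

Let psiP x k i j : U x -> christoffel Gb k i j x =
  christoffel G k i j x + ((k == i)%:R * psi j x + (k == j)%:R * psi i x).
Proof.
move=> /levi_civita[psi' psi'P]; have tr := one_form_trace psi'P.
have psiE l : psi l x = psi' l.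
  have -> : psi' l = n.+1%:R^-1 * (n.+1%:R * psi' l) by rewrite mulKf ?pnatr_eq0.
  rewrite -tr; congr (_ * _); rewrite sumrB.
  by congr (_ - _); apply: eq_bigr => a _; rewrite mxE.
by rewrite !psiE -psi'P subrKC.
Qed.

(** Contracted Christoffel symbols are the gradient of log |det| / 2. *)
Let closed_psi i j x : U x -> partial i (psi j) x = partial j (psi i) x.
Proof.
move=> Ux.
pose T (F : 'rV[R]_n -> 'M[R]_n) j y := \tr (invmx (F y) *m dmx j F y).
have G2 : Ckmx 2 U G := CkmxW (ltnW r2) GU.
have psiE k : {in U, (fun y => n.+1%:R^-1 * (2^-1 * T Gb k y - 2^-1 * T G k y)) =1 psi k}.
  by move=> y /set_mem Uy; rewrite /psi !(trace_christoffel _ oU) ?G1 ?Gb1.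
have dpsi k l : partial k (psi l) x =
    n.+1%:R^-1 * (2^-1 * dlog2 Gb k l x - 2^-1 * dlog2 G k l x).
  rewrite -(near_partial _ oU Ux (psiE l)); apply: partialE.
  have hb := partial_trace_log_derivative k l oU Gb1 GbU Ux.
  have h := partial_trace_log_derivative k l oU G1 G2 Ux.
  have cst_mul (c d : R) (f : 'rV[R]_n -> R) : is_derive x (e_ k) f d ->
      is_derive x (e_ k) (fun y => c * f y) (c * d).
    move=> fd; rewrite -[c * d]add0r -[X in X + _](mul0r (f x)).
    exact: (is_derive_mul (is_derive_cst c x _) fd).
  exact: (cst_mul _ _ _ (is_derive_sub (cst_mul _ _ _ hb) (cst_mul _ _ _ h))).
by rewrite !dpsi (dlog2_sym i j oU GbU Ux) (dlog2_sym i j oU G2 Ux).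
Qed.

Let bs x : U x -> (b x)^T = b x.
Proof. by move=> Ux; rewrite /b trmx_inv Gbs. Qed.

(** The covariant derivative of b for Gb vanishes; the Levi-Civita equations replace
   the Christoffel symbols of Gb by those of G. *)
Let db k i j x : U x -> is_derive x (e_ k) (fun y => b y i j)
  ((i == k)%:R * lam j x + (j == k)%:R * lam i x - 2 * psi k x * b x i j - S k x i j).
Proof.
move=> Ux; have := is_derive_Ckmx k i j (Ckmx_inv oU Gb1 GbU) Ux.
rewrite (dmx_inv k oU Gb1 GbU Ux) (metric_compatibility k oU Gbs Ux (Gb1 Ux)).
rewrite mulmxDr mulmxDl mulmxA mulmxK ?Gb1// mulKmx ?Gb1// -/(b x).
pose C := christoffel_mx Gb k x *m b x.
have -> : b x *m (christoffel_mx Gb k x)^T = C^T by rewrite trmx_mul bs.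
have CE a c : C a c = (christoffel_mx G k x *m b x) a c
    - (a == k)%:R * lam c x + psi k x * b x a c.
  rewrite /C mxE; under eq_bigr do rewrite mxE psiP// mulrDl mulrDl.
  rewrite !big_split/= addrA; congr (_ + _ + _).
  - by rewrite mxE; apply: eq_bigr => l _; rewrite mxE.
  - by rewrite /lam mulrN opprK mulr_sumr; apply: eq_bigr => l _; rewrite -mulrA.
  - rewrite (bigD1 a)//= eqxx mul1r big1 ?addr0// => l la.
    by rewrite eq_sym (negbTE la) !mul0r.
have bij : b x j i = b x i j by rewrite -{1}(bs Ux) mxE.
rewrite -/C => h; apply: (is_derive_eq h); clear h; clearbody C.
have -> : S k x i j = (christoffel_mx G k x *m b x) i j + (christoffel_mx G k x *m b x) j i.
  by rewrite /S mxE [_^T _ _]mxE.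
have -> : (- (C^T + C)) i j = - (C j i + C i j) by rewrite !mxE.
rewrite !CE bij.
move: ((_ *m _) i j) ((_ *m _) j i) (lam i x) (lam j x) (psi k x) (b x i j) => *; ring.
Qed.

Let bU : Ckmx 2 U b := Ckmx_inv oU Gb1 GbU.

Let SU l k : (l < r)%N -> Ckmx l U b -> Ckmx l U (S k).
Proof.
move=> lr blU; have GamU : Ckmx l U (christoffel_mx G k).
  by apply: Ckmx_christoffel => //; exact: CkmxW GU.
have GbU' := Ckmx_mul oU GamU blU; have GbtU := Ckmx_tr oU GbU'.
move=> i j; apply: (@Ck_ext _ _ _ _ (fun x => (christoffel_mx G k x *m b x) i j
  + (christoffel_mx G k x *m b x)^T i j) _ oU).
  by move=> x _; rewrite /S [RHS]mxE.
by apply: Ck_add; [| exact: GbU' | exact: GbtU].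
Qed.

Let psiU j : Ck 1 U (psi j).
Proof.
have trU F : (forall x, U x -> F x \in unitmx) -> Ckmx 2 U F ->
    Ck 1 U (fun x => \tr (christoffel_mx F j x)).
  move=> F1 FU; apply: (Ck_sum _ _ oU) => i; exact: (Ckmx_christoffel j oU F1 FU).
apply: (Ck_mul oU); first exact: Ck_cst.
exact: (Ck_sub_fun oU (trU _ Gb1 GbU) (trU _ G1 (CkmxW (ltnW r2) GU))).
Qed.

Let lamU j : Ck 1 U (lam j).
Proof.
apply: (Ck_opp oU); apply: (Ck_sum _ _ oU) => l; apply: (Ck_mul oU); first exact: psiU.
exact: (CkW (leqnSn 1) (bU l j)).
Qed.

(** This makes psi as smooth as lam and b. *)
Let psi_of_lam j x : U x -> psi j x = - \sum_l lam l x * Gb x l j.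
Proof.
move=> Ux; pose p : 'rV[R]_n := \row_l psi l x.
have : (p *m b x) *m Gb x = p by rewrite mulmxKV ?Gb1.
move=> /rowP/(_ j); rewrite [RHS]mxE => <-; rewrite mxE -sumrN.
by apply: eq_bigr => l _; rewrite /lam mulNr opprK mxE; congr (_ * _);
  apply: eq_bigr => m _; rewrite mxE.
Qed.

Let psiU_of_lam l : Ckmx l U b -> (forall j, Ck l U (lam j)) -> forall j, Ck l U (psi j).
Proof.
move=> blU lU j.
have GblU : Ckmx l U Gb.
  apply: (@Ckmx_ext _ _ _ _ _ _ (fun x => invmx (b x)) _ oU).
    by move=> x _; rewrite /b invmxK.
  by apply: Ckmx_inv => // x Ux; rewrite /b unitmx_inv Gb1.
apply: (@Ck_ext _ _ _ _ (fun x => - \sum_l lam l x * Gb x l j) _ oU).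
  by move=> x /set_mem Ux; rewrite psi_of_lam.
by apply: (Ck_opp oU); apply: (Ck_sum _ _ oU) => m; apply: (Ck_mul oU); [exact: lU|exact: GblU].
Qed.

(** Equality of the mixed derivatives of b along k and m.  The derivatives of psi
   cancel because psi is closed, so the right-hand side has no derivative of lam. *)
Let integrability i j k m x : U x ->
  (i == k)%:R * partial m (lam j) x + (j == k)%:R * partial m (lam i) x
  - ((i == m)%:R * partial k (lam j) x + (j == m)%:R * partial k (lam i) x) =
  partial m (fun y => S k y i j) x - partial k (fun y => S m y i j) x
  + 2 * (psi k x * partial m (fun y => b y i j) x - psi m x * partial k (fun y => b y i j) x).
Proof.
move=> Ux.
have b1U : Ckmx 1 U b by exact: CkmxW bU.
have S1U l : Ckmx 1 U (S l) by apply: SU => //; exact: leq_trans r2.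
pose Q l y := (i == l)%:R * lam j y + (j == l)%:R * lam i y
               - 2 * psi l y * b y i j - S l y i j.
have dQ l a : partial a (Q l) x =
   (i == l)%:R * partial a (lam j) x + (j == l)%:R * partial a (lam i) x
   - 2 * (partial a (psi l) x * b x i j + psi l x * partial a (fun y => b y i j) x)
   - partial a (fun y => S l y i j) x.
  apply: partialE.
  have cst_mul (c d : R) (f : 'rV[R]_n -> R) : is_derive x (e_ a) f d ->
      is_derive x (e_ a) (fun y => c * f y) (c * d).
    move=> fd; rewrite -[c * d]add0r -[X in X + _](mul0r (f x)).
    exact: (is_derive_mul (is_derive_cst c x _) fd).
  have hl p := Ck_is_derive a (lamU p) Ux.
  have hp := Ck_is_derive a (psiU l) Ux.
  have hb := Ck_is_derive a (b1U i j) Ux.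
  have hS := Ck_is_derive a (S1U l i j) Ux.
  rewrite /Q; under eq_fun do rewrite -mulrA.
  exact: (is_derive_sub (is_derive_sub (is_derive_add (cst_mul _ _ _ (hl j))
    (cst_mul _ _ _ (hl i))) (cst_mul _ _ _ (is_derive_mul hp hb))) hS).
have bQ l : {in U, partial l (fun y => b y i j) =1 Q l}.
  by move=> y /set_mem Uy; apply: partialE; exact: db.
have sym : partial m (Q k) x = partial k (Q m) x.
  rewrite -(near_partial _ oU Ux (bQ k)) -(near_partial _ oU Ux (bQ m)).
  apply/esym/partialE; apply: (@partial_swap _ _ U) => //.
  - by move=> y Uy; exact: Ck_derivable (bU i j) Uy.
  - by move=> y Uy; exact: Ck_derivable (bU i j) Uy.
  - by move=> y Uy; exact: Ck_derivable (Ck_partial _ (bU i j)) Uy.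
  - exact: Ck_continuous (Ck_partial _ (Ck_partial _ (bU i j))) Ux.
move: sym; rewrite !dQ (closed_psi k m Ux).
move: (partial m (lam j) x) (partial m (lam i) x) (partial k (lam j) x)
  (partial k (lam i) x) (partial m (psi k) x) (psi k x) (psi m x) (b x i j)
  (partial m (fun y => b y i j) x) (partial k (fun y => b y i j) x)
  (partial m (fun y => S k y i j) x) (partial k (fun y => S m y i j) x)
  => v1 v2 v3 v4 v5 v6 v7 v8 v9 v10 v11 v12 H.
by apply/eqP; rewrite -subr_eq0; apply/eqP; move/eqP: H; rewrite -subr_eq0 => /eqP <-; ring.
Qed.

Let regularity_step s : (s.+1 < r.-1)%N -> Ckmx s.+2 U b ->
  (forall j, Ck s.+1 U (lam j)) -> forall j, Ck s.+2 U (lam j).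
Proof.
move=> sr bsU lsU.
have psU := psiU_of_lam (CkmxW (leqnSn _) bsU) lsU.
have SsU k : Ckmx s.+2 U (S k) by apply: SU => //; rewrite -ltn_predRL.
pose H i j k m x := partial m (fun y => S k y i j) x - partial k (fun y => S m y i j) x
  + 2 * (psi k x * partial m (fun y => b y i j) x - psi m x * partial k (fun y => b y i j) x).
have HU i j k m : Ck s.+1 U (H i j k m).
  apply: (Ck_add oU).
    by apply: (Ck_sub_fun oU); apply: Ck_partial; exact: SsU.
  apply: (Ck_mul oU); first exact: Ck_cst.
  by apply: (Ck_sub_fun oU); apply: (Ck_mul oU); [exact: psU|exact: Ck_partial (bsU _ _)|
    exact: psU|exact: Ck_partial (bsU _ _)].
apply: Ck_gain_diagonal => //.
  move=> m k mk.
  apply: (@Ck_ext _ _ _ _ (fun x => 2^-1 * H k k k m x) _ oU).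
    move=> x /set_mem Ux; rewrite /H -integrability// eqxx eq_sym (negbTE mk).
    by rewrite !mul1r !mul0r addr0 subr0; move: (partial m _ x) => v; field.
  by apply: (Ck_mul oU); [exact: Ck_cst|exact: HU].
move=> m k mk; apply: (@Ck_ext _ _ _ _ (H m k k m) _ oU); last exact: HU.
move=> x /set_mem Ux; rewrite /H -integrability// !eqxx (eq_sym k) (negbTE mk).
by rewrite !mul1r !mul0r add0r addr0.
Qed.

(** If lam is C^(s+1) and b is C^(s+2), the right-hand side of [integrability] is
    C^(s+1) as long as the Christoffel symbols of G are C^(s+2).  For i = j = k it
    gives the derivatives [partial m (lam k)] with m <> k, and for i = m, j = k the
    differences of diagonal derivatives, so lam is C^(s+2) by [Ck_gain_diagonal];
    then [db] makes b of class C^(s+3).  The bootstrap starts at s = 0, where b is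
    C^2, and stops when b is C^r. *)
Lemma levi_civita_regularity : Ckmx r U Gb.
Proof.
have main s : (s.+1 < r)%N -> Ckmx s.+2 U b /\ forall j, Ck s.+1 U (lam j).
  elim: s => [//|s IH] sr; have [bsU lsU] := IH (ltnW sr).
  have ls2 : forall j, Ck s.+2 U (lam j).
    by apply: regularity_step => //; rewrite ltn_predRL.
  split=> // i j.
  have ps2 := psiU_of_lam bsU ls2.
  apply: (@CkS_intro _ _ _ _ _ (fun k x => (i == k)%:R * lam j x + (j == k)%:R * lam i x
    - 2 * psi k x * b x i j - S k x i j) oU).
  - by move=> x k Ux; exact: db.
  - exact: CkW (bsU i j).
  - move=> k; apply: (Ck_sub_fun oU); last exact: (SU _ sr bsU).
    apply: (Ck_sub_fun oU).
      by apply: (Ck_add oU); apply: (Ck_mul oU);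
        [exact: Ck_cst|exact: ls2|exact: Ck_cst|exact: ls2].
    by apply: (Ck_mul oU); [apply: (Ck_mul oU); [exact: Ck_cst|exact: ps2]|exact: bsU].
have [brU _] : Ckmx r U b /\ forall j, Ck r.-1 U (lam j).
  by case: r r2 main => // -[//|r'] _ /(_ r'); apply.
apply: (@Ckmx_ext _ _ _ _ _ _ (fun x => invmx (b x)) _ oU).
  by move=> x _; rewrite /b invmxK.
by apply: Ckmx_inv => // x Ux; rewrite /b unitmx_inv Gb1.
Qed.

End LeviCivita.
End Regularity.

(** * Existence of geodesics *)

Section Picard.
Context {R : realType}.

Lemma continuous_antiderivative (f : R -> R) (a : R) : 0 < a -> continuous f ->
  exists P : R -> R, P 0 = 0 /\ forall t, `|t| < a -> is_derive t (1 : R) P (f t).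
Proof.
move=> a0 cf.
pose F (t : R) := (\int[lebesgue_measure]_(s in `[(- a)%R, t]) f s)%R.
exists (fun t => F t - F 0); split; first by rewrite subrr.
move=> t ta; have /andP[t1 t2] : - a < t < a by rewrite -ltr_norml.
have [] := @continuous_FTC1_closed R f (- a) t a t2.
- apply: continuous_compact_integrable; first exact: segment_compact.
  exact: continuous_subspaceT.
- exact: t1.
- exact: cf.
move=> dF F'; rewrite -[f t]subr0; apply: is_derive_sub.
by apply: DeriveDef; [exact: dF|rewrite -derive1E; exact: F'].
Qed.

Section Iteration.
Context {m : nat}.
Variables (F : 'rV[R]_m -> 'rV[R]_m) (y0 : 'rV[R]_m) (L : R).
Hypotheses (L0 : 0 < L) (FL : forall x y, `|F x - F y| <= L * `|x - y|).

(** On a time interval of this radius the integral operator contracts by 1/2. *)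
Let delta : R := (2 * L)^-1.
Let delta0 : 0 < delta. Proof. by rewrite invr_gt0 mulr_gt0. Qed.

(** Freezing the time outside the interval keeps all curves defined and continuous
   on R, so that the estimates are uniform on R. *)
Let clamp (t : R) := Num.max (- delta) (Num.min t delta).

Let clamp_le t : `|clamp t| <= delta.
Proof.
rewrite ler_norml /clamp le_max lexx/= ge_max ge_min lexx orbT andbT.
by rewrite (le_trans _ (ltW delta0))// oppr_le0 ltW.
Qed.

Let clampE t : `|t| < delta -> clamp t = t.
Proof.
rewrite ltr_norml => /andP[t1 t2]; rewrite /clamp min_l ?ltW//.
by rewrite max_r// ltW.
Qed.

Let clamp_continuous : continuous clamp.
Proof.
move=> t; apply: (@continuous_max _ _ (fun=> - delta) (fun t => Num.min t delta)).
  exact: cst_continuous.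
apply: (@continuous_min _ _ id (fun=> delta)); first exact: cvg_id.
exact: cst_continuous.
Qed.

Let Fcont : continuous F.
Proof.
move=> x; apply/(@cvgrPdist_lt _ _ _ (nbhs x) _ F (F x)) => e e0; near=> y.
apply: le_lt_trans (FL _ _) _; rewrite mulrC -ltr_pdivlMr//.
near: y; apply/nbhs_ballP; exists (e / L); first exact: divr_gt0.
by move=> y; rewrite -ball_normE.
Unshelve. all: by end_near. Qed.

Let primitive (g : R -> 'rV[R]_m) : continuous g ->
  exists P : R -> 'rV[R]_m, P 0 = 0 /\ forall t, `|t| < delta * 2 ->
    is_derive t (1 : R) P (g t).
Proof.
move=> cg; have d2 : 0 < delta * 2 by rewrite mulr_gt0.
have coordP (i : 'I_m) := cid (continuous_antiderivative d2
  (fun t => continuous_comp (cg t) (@coord_continuous _ _ _ 0 i (g t)))).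
exists (fun t => \row_i sval (coordP i) t); split.
  by apply/rowP => i; rewrite !mxE; have [] := svalP (coordP i).
move=> t td; apply: is_derive_rV => j; have [_ /(_ t td)] := svalP (coordP j).
by under [X in _ -> is_derive _ _ X _]eq_fun do rewrite mxE.
Qed.

Let picard_step (y z : R -> 'rV[R]_m) := exists P : R -> 'rV[R]_m,
  [/\ P 0 = 0, forall t, `|t| < delta * 2 -> is_derive t (1 : R) P (F (y t)) &
      forall t, z t = y0 + P (clamp t)].

Let clamp_lt t : `|clamp t| < delta * 2.
Proof. by apply: le_lt_trans (clamp_le t) _; rewrite ltr_pMr// ltr1n. Qed.

Let derivative_bound_curve (D d : R -> 'rV[R]_m) (M : R) : 0 <= M -> D 0 = 0 ->
  (forall t, `|t| < delta * 2 -> is_derive t (1 : R) D (d t) /\ `|d t| <= M) ->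
  forall t, `|D (clamp t)| <= M * delta.
Proof.
move=> M0 D0 Dd t; apply: row_norm_le => [|i]; first by rewrite mulr_ge0// ltW.
have -> : D (clamp t) 0 i = D (clamp t) 0 i - D 0 0 i by rewrite D0 mxE subr0.
apply: le_trans (_ : M * `|clamp t - 0| <= _); last first.
  by rewrite subr0 ler_wpM2l.
apply: (@bounded_derivative_lipschitz _ (fun s => D s 0 i)) => s sb.
have sd : `|s| < delta * 2.
  apply: le_lt_trans (clamp_lt t); move: sb; rewrite ge_min le_max => /andP[sb1 sb2].
  have := ler_norm (clamp t); have := ler_norm (- clamp t); rewrite normrN.
  move: (clamp t) sb1 sb2 => c sb1 sb2 c1 c2; have := normr_ge0 c => c3.
  by rewrite ler_norml; move: sb1 sb2 => /orP[] ? /orP[] ?; apply/andP; split; lra.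
have [[Ds dsE] ds] := Dd s sd; split; first by move/derivable_mxP: Ds.
have <- : d s 0 i = 'D_1 (fun s => D s 0 i) s.
  by rewrite -dsE derive_mx// mxE.
exact: le_trans (row_norm_coord _ _) ds.
Qed.

Let picard_contract y z y' z' M : 0 <= M -> picard_step y y' -> picard_step z z' ->
  (forall t, `|y t - z t| <= M) -> forall t, `|y' t - z' t| <= M / 2.
Proof.
move=> M0 [P [P0 dP y'E]] [Q [Q0 dQ z'E]] yz t; rewrite y'E z'E opprD addrACA subrr add0r.
have -> : M / 2 = L * M * delta.
  by rewrite /delta; field; rewrite gt_eqF.
apply: (derivative_bound_curve (D := fun s => P s - Q s) (d := fun s => F (y s) - F (z s))).
- by rewrite mulr_ge0// ltW.
- by rewrite P0 Q0 subrr.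
move=> s sd; split; first exact: (is_deriveB (dP s sd) (dQ s sd)).
by apply: le_trans (FL _ _) _; rewrite ler_wpM2l// ltW.
Qed.

Let picard_next y : continuous y -> exists2 z, continuous z & picard_step y z.
Proof.
move=> cy; have [|P [P0 dP]] := @primitive (F \o y).
  by move=> t; apply: continuous_comp; [exact: cy|exact: Fcont].
exists (fun t => y0 + P (clamp t)); last by exists P.
move=> t; apply: (@continuousD _ _ _ (fun=> y0) (P \o clamp)); first exact: cst_continuous.
apply: continuous_comp; first exact: clamp_continuous.
apply: differentiable_continuous; apply/derivable1_diffP.
by have [] := dP _ (clamp_lt t).
Qed.

Let curve := {y : R -> 'rV[R]_m | continuous y}.

Let next (y : curve) : {z : curve | picard_step (sval y) (sval z)}.
Proof.
apply: cid; have [z cz yz] := picard_next (svalP y).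
by exists (exist _ z cz).
Qed.

Let u (k : nat) : R -> 'rV[R]_m :=
  sval (iter k (fun y => sval (next y)) (exist _ (fun=> y0) (@cst_continuous _ _ y0))).

Let uS k : picard_step (u k) (u k.+1).
Proof. exact: (svalP (next _)). Qed.

Let uc k : continuous (u k).
Proof.
exact: (svalP (iter k (fun y => sval (next y))
  (exist _ (fun=> y0) (@cst_continuous _ _ y0)))).
Qed.

Let C := `|F y0| * delta.

Let C0 : 0 <= C. Proof. by rewrite mulr_ge0// ltW. Qed.

Let u_dist k t : `|u k.+1 t - u k t| <= C * 2^-1 ^+ k.
Proof.
elim: k t => [|k IH] t.
  have [P [P0 dP uE]] := uS 0; rewrite uE /u/= addrC addKr expr0 mulr1.
  by apply: (derivative_bound_curve _ P0) => // s sd; split; first exact: dP.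
have := picard_contract _ (uS k.+1) (uS k) IH t.
by rewrite exprSr mulrA; apply; rewrite mulr_ge0// exprn_ge0// invr_ge0.
Qed.

Let geo_ge0 k : 0 <= 2 * C * 2^-1 ^+ k.
Proof.
by apply: mulr_ge0; [apply: mulr_ge0; [exact: ler0n|exact: C0]|rewrite exprn_ge0// invr_ge0].
Qed.

Let u_cauchy k j t : `|u (k + j)%N t - u k t| <= 2 * C * 2^-1 ^+ k.
Proof.
apply: le_trans (_ : 2 * C * (2^-1 ^+ k - 2^-1 ^+ (k + j)) <= _); last first.
  by apply: ler_wpM2l; [rewrite mulr_ge0|rewrite gerBl exprn_ge0// invr_ge0].
elim: j => [|j IH]; first by rewrite addn0 !subrr normr0 mulr0.
rewrite addnS -(subrKA (u (k + j) t)); apply: le_trans (ler_normD _ _) _.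
apply: le_trans (lerD (u_dist _ _) IH) _; rewrite exprS.
by rewrite le_eqVlt; apply/orP; left; apply/eqP; field.
Qed.

Let small (e : R) : 0 < e -> exists k, 2 * C * 2^-1 ^+ k < e.
Proof.
move=> e0.
have h : `|2^-1 : R| < 1 by rewrite ger0_norm ?invf_lt1 ?ltr1n.
have /cvgrPdist_lt/(_ _ e0) := cvg_geometric (2 * C) h.
move=> [k _ /(_ k (leqnn k))]/=; rewrite sub0r normrN => H; exists k.
by apply: le_lt_trans H; exact: ler_norm.
Qed.

Let u_cvg t i : cvgn (fun k => u k t 0 i).
Proof.
have h : `|2^-1 : R| < 1 by rewrite ger0_norm ?invf_lt1 ?ltr1n.
have sc : cvgn (series (fun k => u k.+1 t 0 i - u k t 0 i)).
  apply: normed_cvg; apply: (@series_le_cvg _ _ (geometric C 2^-1)).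
  - by move=> k; exact: normr_ge0.
  - by move=> k; rewrite /geometric/= mulr_ge0// exprn_ge0// invr_ge0.
  - move=> k; apply: le_trans (u_dist k t); apply: le_trans (row_norm_coord _ i).
    by rewrite !mxE.
  - exact: is_cvg_geometric_series.
have -> : (fun k => u k t 0 i) =
    (fun k => u 0%N t 0 i + series (fun k => u k.+1 t 0 i - u k t 0 i) k).
  by apply/funext => k; rewrite seriesEnat/= telescope_sumr// subrKC.
by apply: is_cvgD => //; exact: is_cvg_cst.
Qed.

Let z t : 'rV[R]_m := \row_i lim ((fun k => u k t 0 i) @ \oo).

Let z_dist k t : `|z t - u k t| <= 2 * C * 2^-1 ^+ k.
Proof.
apply: row_norm_le => [|i]; first exact: geo_ge0.
have h : (fun j => `|u j t 0 i - u k t 0 i|) @ \oo --> `|z t 0 i - u k t 0 i|.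
  apply: cvg_norm; apply: cvgB; last exact: cvg_cst.
  by rewrite mxE; exact: u_cvg.
have coordB (x y : 'rV[R]_m) : (x - y) 0 i = x 0 i - y 0 i by rewrite !mxE.
rewrite coordB.
apply: (ler_cvg_to h (cvg_cst (2 * C * 2^-1 ^+ k))).
exists k => // j /= kj; apply: le_trans (u_cauchy k (j - k) t).
by rewrite subnKC// -coordB row_norm_coord.
Qed.

Let z_continuous : continuous z.
Proof.
move=> t; apply/cvgrPdist_lt => e e0.
have [k ke] := small (divr_gt0 e0 (ltr0n _ 3)).
have /cvgrPdist_lt/(_ _ (divr_gt0 e0 (ltr0n _ 3))) H := @uc k t.
near=> s.
have -> : z t - z s = (z t - u k t) + (u k t - u k s) + (u k s - z s).
  by rewrite subrKA subrKA.
apply: le_lt_trans (ler_normD _ _) _.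
have -> : e = e / 3 + e / 3 + e / 3 by field.
apply: ltrD; last by rewrite distrC; exact: le_lt_trans (z_dist _ _) ke.
apply: le_lt_trans (ler_normD _ _) _; apply: ltrD.
  exact: le_lt_trans (z_dist _ _) ke.
by near: s.
Unshelve. all: by end_near. Qed.

(** The iterates of the integral operator are uniformly Cauchy.  The image w of
    their limit z is also a limit of the iterates, so w = z and z is a primitive
    of F along z. *)
Lemma picard_lindelof_global :
  exists2 y : R -> 'rV[R]_m, y 0 = y0 &
    exists2 d : R, 0 < d & forall t, `|t| < d -> is_derive t (1 : R) y (F (y t)).
Proof.
have [w cw zw] := picard_next z_continuous.
have wz t : w t = z t.
  apply/eqP; rewrite -subr_eq0 -normr_le0; apply/ler_addgt0Pr => e e0; rewrite add0r.
  have [k ke] := small e0.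
  rewrite -(subrKA (u k.+1 t)); apply: le_trans (ler_normD _ _) _.
  have h1 := z_dist k.+1 t; rewrite distrC in h1.
  have h2 := picard_contract _ zw (uS k) (z_dist k) t.
  apply: le_trans (lerD (h2 _) h1) _.
    exact: geo_ge0.
  apply: le_trans (ltW ke); rewrite exprSr.
  by rewrite le_eqVlt; apply/orP; left; apply/eqP; field.
have [P [P0 dP wE]] := zw.
exists z.
  by rewrite -wz wE clampE ?normr0// P0 addr0.
exists delta => // t td.
have dz : is_derive t (1 : R) (fun s => y0 + P s) (F (z t)).
  rewrite -[F _]add0r; apply: (is_deriveD (is_derive_cst _ _ _)).
  by apply: dP; apply: lt_trans td _; rewrite ltr_pMr// ltr1n.
apply: near_eq_is_derive dz.
near=> s; rewrite -wz wE clampE//.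
near: s; apply/nbhs_ballP; exists (delta - `|t|); first by rewrite /= subr_gt0.
move=> s; rewrite -ball_normE/= => ts.
rewrite -(subrK t s); apply: le_lt_trans (ler_normD _ _) _.
by rewrite -ltrBrDr distrC.
Unshelve. all: by end_near. Qed.

End Iteration.
End Picard.

Section LocalPicard.
Context {R : realType} {m : nat}.

Lemma clamp_lipschitz (a b s t : R) : a <= b ->
  `|Num.max a (Num.min s b) - Num.max a (Num.min t b)| <= `|s - t|.
Proof.
move=> ab; wlog st : s t / s <= t => [H|].
  by have [/H//|/H] := orP (le_total s t); rewrite distrC (distrC t).
rewrite ler_norml; have := ler0_norm (_ : s - t <= 0); rewrite subr_le0 => /(_ st) ->.
rewrite !maxEle !minEle.
by case: (leP s b) => ?; case: (leP t b) => ?;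
  do ?[case: ifPn; rewrite -?ltNge => ?]; apply/andP; split; lra.
Qed.

(** Near y0 the field is Lipschitz; precomposed with a Lipschitz retraction onto a
    box it becomes globally so, and the solution stays in the box for small times. *)
Lemma picard_lindelof (W : set 'rV[R]_m) (F : 'rV[R]_m -> 'rV[R]_m) (y0 : 'rV[R]_m) :
  open W -> W y0 -> Ckmap 1 W F ->
  exists2 y : R -> 'rV[R]_m, y 0 = y0 & exists2 d : R, 0 < d &
    forall t, `|t| < d -> W (y t) /\ is_derive t (1 : R) y (F (y t)).
Proof.
move=> oW Wy0 FW.
pose C : R := \sum_i \sum_j `|partial i (fun y => F y 0 j) y0| + 1.
have C0 : 0 < C by rewrite ltr_wpDl// sumr_ge0// => i _; rewrite sumr_ge0.
have nearC i j : \forall y \near y0, `|partial i (fun y => F y 0 j) y| <= C.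
  have c := Ck_continuous (Ck_partial i (FW j)) Wy0.
  apply: (cvgr_norm_le (partial i (fun y => F y 0 j) y0) c).
  apply: le_lt_trans (_ : _ <= C - 1) _; last by rewrite ltrBlDr ltrDl.
  rewrite /C addrK (bigD1 i)//= (bigD1 j)//= -addrA lerDl addr_ge0//.
    by rewrite sumr_ge0.
  by rewrite sumr_ge0// => k _; rewrite sumr_ge0.
have nearB : \forall y \near y0, W y /\ forall i j, `|partial i (fun y => F y 0 j) y| <= C.
  have H1 := open_nbhs_nbhs (conj oW Wy0).
  have H2 : \forall y \near y0, forall p : 'I_m * 'I_m,
      `|partial p.1 (fun y => F y 0 p.2) y| <= C.
    exact: (@filter_forall _ _ (fun (p : 'I_m * 'I_m) y =>
      `|partial p.1 (fun y => F y 0 p.2) y| <= C) (nbhs y0) _ (fun p => nearC p.1 p.2)).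
  by apply: filterS2 _ H1 H2 => y Wy Cy; split=> // i j; exact: (Cy (i, j)).
have /nbhs_ballP[e/= e0 eP] := nearB.
pose L : R := m%:R * C + 1.
have L0 : 0 < L by rewrite ltr_wpDl// mulr_ge0// ltW.
have Flip x y : ball y0 e x -> ball y0 e y -> `|F y - F x| <= L * `|y - x|.
  move=> xe ye; apply: row_norm_le => [|j]; first by rewrite mulr_ge0// ltW.
  have -> : (F y - F x) 0 j = F y 0 j - F x 0 j by rewrite !mxE.
  apply: le_trans (_ : m%:R * C * `|y - x| <= _); last first.
    by apply: ler_wpM2r => //; rewrite /L lerDl.
  apply: (partial_bound_lipschitz (f := fun y => F y 0 j) _ xe ye) => z /eP[Wz zC] i.
  by split=> //; exact: Ck_derivable (FW j) Wz.
pose ret (y : 'rV[R]_m) : 'rV[R]_m :=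
  \row_j Num.max (y0 0 j - e / 2) (Num.min (y 0 j) (y0 0 j + e / 2)).
have e2 : 0 < e / 2 by rewrite divr_gt0.
have ret_ball y : ball y0 e (ret y).
  apply/row_ballP => // j; rewrite mxE.
  move: (y0 0 j) (y 0 j) => a b.
  have h1 : a - e / 2 <= Num.max (a - e / 2) (Num.min b (a + e / 2)) by rewrite le_max lexx.
  have h2 : Num.max (a - e / 2) (Num.min b (a + e / 2)) <= a + e / 2.
    by rewrite ge_max ge_min lexx orbT andbT; lra.
  by rewrite ltr_norml; apply/andP; split; lra.
have ret_lip x y : `|ret x - ret y| <= `|x - y|.
  apply: row_norm_le => // j; rewrite !mxE.
  apply: le_trans (clamp_lipschitz _ _ _) _; first by lra.
  by have := row_norm_coord (x - y) j; rewrite !mxE.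
have ret_id (y : 'rV[R]_m) : (forall j, `|y0 0 j - y 0 j| < e / 2) -> ret y = y.
  move=> yP; apply/rowP => j; rewrite mxE; have := yP j.
  rewrite ltr_norml => /andP[h1 h2]; by rewrite min_l ?max_r//; lra.
have [y yy0 [d d0 dP]] := @picard_lindelof_global R m (F \o ret) y0 L L0
  (fun x y => le_trans (Flip _ _ (ret_ball y) (ret_ball x)) (ler_wpM2l (ltW L0) (ret_lip x y))).
have cy : {for 0, continuous y}.
  apply: differentiable_continuous; apply/derivable1_diffP.
  by have [] := dP 0; rewrite ?normr0.
have /nbhs_ballP[d' /= d'0 d'P] : \forall t \near (0 : R), ball y0 (e / 2) (y t).
  by have /cvg_ballP/(_ _ e2) := cy; rewrite yy0.
exists y => //; exists (Num.min d d'); first by rewrite lt_min d0.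
move=> t; rewrite lt_min => /andP[td td'].
have yt : ball y0 (e / 2) (y t) by apply: d'P; rewrite -ball_normE/= sub0r normrN.
have yret : ret (y t) = y t by apply: ret_id; apply/row_ballP.
split; first by have [] := eP _ (ret_ball (y t)); rewrite yret.
by have := dP t td; rewrite /= yret.
Qed.

End LocalPicard.

Section GeodesicFlow.
Context {R : realType} {n : nat}.

(** The quadratic part of the geodesic equation: x'' = - spray G x x'. *)
Definition spray (G : 'rV[R]_n -> 'M[R]_n) (x v : 'rV[R]_n) : 'rV[R]_n :=
  \row_l \sum_i \sum_j christoffel G l i j x * v 0 i * v 0 j.

(** The geodesic equation as a first-order system for the pair (x, v) in R^(n+n). *)
Lemma geodesic_existence (V : set 'rV[R]_n) (G : 'rV[R]_n -> 'M[R]_n) (x0 v0 : 'rV[R]_n) :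
  open V -> V x0 -> v0 != 0 -> Ckmx 2 V G -> (forall x, V x -> G x \in unitmx) ->
  exists x : R -> 'rV[R]_n, exists v : R -> 'rV[R]_n, exists d : R,
  [/\ 0 < d, x 0 = x0, v 0 = v0 & forall t, `|t| < d ->
    [/\ V (x t), v t != 0, is_derive t (1 : R) x (v t) &
        is_derive t (1 : R) v (- spray G (x t) (v t))]].
Proof.
move=> oV Vx0 v00 GV G1.
pose F (y : 'rV[R]_(n + n)) : 'rV[R]_(n + n) :=
  row_mx (rsubmx y) (- spray G (lsubmx y) (rsubmx y)).
pose W : set 'rV[R]_(n + n) := [set y | V (lsubmx y)].
have lC k (U : set 'rV[R]_(n + n)) : open U -> Ckmap k U (@lsubmx R 1 n n).
  by move=> oU j; apply: (Ck_ext oU _ (Ck_coord k (lshift n j) oU)) => y _; rewrite mxE.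
have rC k (U : set 'rV[R]_(n + n)) j : open U -> Ck k U (fun y => rsubmx y 0 j).
  by move=> oU; apply: (Ck_ext oU _ (Ck_coord k (rshift n j) oU)) => y _; rewrite mxE.
have oW : open W.
  apply: open_comp oV => y _.
  exact: (continuous_Ckmap (lC 0%N setT openT) I).
have chrV i j l : Ck 1 V (christoffel G l i j).
  apply: Ck_ext oV _ (Ckmx_christoffel i oV G1 GV l j) => x _.
  by rewrite mxE.
have FW : Ckmap 1 W F.
  move=> j; case: (split_ordP j) => i ->.
    by apply: (Ck_ext oW _ (rC 1%N W i oW)) => y _; rewrite row_mxEl.
  apply: (@Ck_ext _ _ _ _ (fun y => - \sum_a \sum_b
    christoffel G i a b (lsubmx y) * rsubmx y 0 a * rsubmx y 0 b) _ oW).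
    by move=> y _; rewrite row_mxEr mxE [in RHS]mxE.
  apply: (Ck_opp oW); apply: (Ck_sum _ _ oW) => a; apply: (Ck_sum _ _ oW) => b.
  apply: (Ck_mul oW); last exact: rC.
  apply: (Ck_mul oW); last exact: rC.
  exact: (Ck_comp oW oV (fun y Wy => Wy) (lC 1%N W oW) (chrV a b i)).
have Wy0 : W (row_mx x0 v0) by rewrite /W/= row_mxKl.
have [y yy0 [d d0 dP]] := picard_lindelof oW Wy0 FW.
pose x t := lsubmx (y t); pose v t := rsubmx (y t).
have dx t : `|t| < d -> is_derive t (1 : R) x (v t).
  move=> /dP[_ [yd yE]]; apply: is_derive_rV => j.
  have -> : (fun s => x s 0 j) = (fun s => y s 0 (lshift n j)).
    by apply/funext => s; rewrite mxE.
  apply: DeriveDef; first by move/derivable_mxP: yd.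
  by move/rowP: yE => /(_ (lshift n j)); rewrite derive_mx// mxE row_mxEl.
have dv t : `|t| < d -> is_derive t (1 : R) v (- spray G (x t) (v t)).
  move=> /dP[_ [yd yE]]; apply: is_derive_rV => j.
  have -> : (fun s => v s 0 j) = (fun s => y s 0 (rshift n j)).
    by apply/funext => s; rewrite mxE.
  apply: DeriveDef; first by move/derivable_mxP: yd.
  by move/rowP: yE => /(_ (rshift n j)); rewrite derive_mx// mxE row_mxEr.
have x00 : x 0 = x0 by rewrite /x yy0 row_mxKl.
have v0E : v 0 = v0 by rewrite /v yy0 row_mxKr.
have cv : {for 0, continuous v}.
  apply: differentiable_continuous; apply/derivable1_diffP.
  by have [] := dv 0; rewrite ?normr0.
have nv : 0 < `|v0| by rewrite normr_gt0.
have /nbhs_ballP[d' /= d'0 d'P] : \forall t \near (0 : R), `|v 0 - v t| < `|v0|.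
  by move/cvgrPdist_lt : cv => /(_ _ nv).
exists x, v, (Num.min d d'); split => //; first by rewrite lt_min d0.
move=> t; rewrite lt_min => /andP[td td']; split.
- by have [] := dP t td.
- have /d'P : ball 0 d' t by rewrite -ball_normE/= sub0r normrN.
  by rewrite v0E; apply: contraTneq => ->; rewrite subr0 ltxx.
- exact: dx.
- exact: dv.
Qed.

End GeodesicFlow.

(** * Covariance of the geodesic equation *)

Section SprayTransport.
Context {R : realType} {n : nat}.
Implicit Types (v w : 'rV[R]_n) (G : 'rV[R]_n -> 'M[R]_n).

Definition quad_row (D : 'I_n -> 'M[R]_n) v : 'rV[R]_n :=
  \row_m (v *m D m *m v^T) 0 0.

Definition dir_mx (D : 'I_n -> 'M[R]_n) v : 'M[R]_n := \sum_i v 0 i *: D i.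

(** With D i the i-th derivative of G, the Euler-Lagrange covector of the Lagrangian
    v *m G *m v^T / 2 is [a *m G + lagrange_row D v], a being the acceleration. *)
Definition lagrange_row (D : 'I_n -> 'M[R]_n) v : 'rV[R]_n :=
  v *m dir_mx D v - 2^-1 *: quad_row D v.

Lemma dir_mxE (D : 'I_n -> 'M[R]_n) v a b : dir_mx D v a b = \sum_i v 0 i * D i a b.
Proof. by rewrite /dir_mx summxE; apply: eq_bigr => i _; rewrite mxE. Qed.

Lemma quad_rowE (D : 'I_n -> 'M[R]_n) v m :
  quad_row D v 0 m = \sum_i \sum_j v 0 i * v 0 j * D m i j.
Proof.
rewrite !mxE exchange_big/=; apply: eq_bigr => j _; rewrite !mxE mulr_suml.
by apply: eq_bigr => i _; ring.
Qed.

Lemma lagrange_rowE (D : 'I_n -> 'M[R]_n) v m :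
  lagrange_row D v 0 m = (v *m dir_mx D v) 0 m - 2^-1 * quad_row D v 0 m.
Proof.
rewrite /lagrange_row; move: (v *m _) (quad_row _ _) => A B.
by rewrite !mxE.
Qed.

Lemma spray_lagrange U G x v : open U -> U x -> (forall y, U y -> (G y)^T = G y) ->
  G x \in unitmx -> spray G x v *m G x = lagrange_row (fun i => dmx i G x) v.
Proof.
move=> oU Ux Gs G1; apply/rowP => m.
have -> : (spray G x v *m G x) 0 m =
    \sum_i \sum_j v 0 i * v 0 j * (G x *m christoffel_mx G i x) m j.
  rewrite mxE; transitivity (\sum_l \sum_i \sum_j
     christoffel G l i j x * v 0 i * v 0 j * G x l m).
    apply: eq_bigr => l _; rewrite mxE mulr_suml; apply: eq_bigr => i _.
    by rewrite mulr_suml.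
  rewrite exchange_big/=; apply: eq_bigr => i _; rewrite exchange_big/=.
  apply: eq_bigr => j _; rewrite mxE mulr_sumr; apply: eq_bigr => l _.
  by rewrite -{1}(Gs _ Ux) !mxE; ring.
pose D i := dmx i G x; rewrite -/D.
have chrE i m' j : (G x *m christoffel_mx G i x) m' j = 2^-1 * (D i j m' + D j i m' - D m' i j).
  by rewrite mul_christoffel_mx// mxE [X in _ * X]mxE.
under eq_bigr => i _ do under eq_bigr => j _ do rewrite chrE.
clearbody D.
have -> : lagrange_row D v 0 m = \sum_i \sum_j v 0 i * v 0 j * D i j m
    - 2^-1 * \sum_i \sum_j v 0 i * v 0 j * D m i j.
  rewrite lagrange_rowE quad_rowE; congr (_ - _).
  rewrite mxE exchange_big/=; apply: eq_bigr => j _; rewrite dir_mxE mulr_sumr.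
  by apply: eq_bigr => i _; ring.
have sym : \sum_i \sum_j v 0 i * v 0 j * D j i m = \sum_i \sum_j v 0 i * v 0 j * D i j m.
  rewrite exchange_big/=; apply: eq_bigr => i _; apply: eq_bigr => j _.
  by rewrite (mulrC (v 0 i)).
transitivity (2^-1 * (\sum_i \sum_j v 0 i * v 0 j * D i j m
  + \sum_i \sum_j v 0 i * v 0 j * D j i m - \sum_i \sum_j v 0 i * v 0 j * D m i j)).
  rewrite -big_split -sumrB mulr_sumr; apply: eq_bigr => i _.
  rewrite -big_split -sumrB mulr_sumr; apply: eq_bigr => j _.
  by rewrite /=; ring.
by rewrite sym; field.
Qed.

(** The derivatives of a pullback J G' J^T, with K m the derivatives of J and E a
    those of G'.  The two terms with [K m] in the quadratic form are equal, and by
    the symmetry of second derivatives (the hypothesis on K) they cancel the third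
    term of [dir_mx]: the Euler-Lagrange covector is covariant. *)
Lemma lagrange_row_pullback (J H : 'M[R]_n) (K E : 'I_n -> 'M[R]_n) v :
  H^T = H -> (forall m i a, K m i a = K i m a) ->
  lagrange_row (fun m => K m *m H *m J^T + J *m dir_mx E (row m J) *m J^T
                         + J *m H *m (K m)^T) v =
  (v *m dir_mx K v *m H + lagrange_row E (v *m J)) *m J^T.
Proof.
move=> Hs Ks; set w := v *m J; set D := fun m => _.
have rowK m : row m (dir_mx K v) = v *m K m.
  apply/rowP => a; rewrite [LHS]mxE dir_mxE mxE; apply: eq_bigr => i _.
  by rewrite Ks.
have dirE (A B C : 'I_n -> 'M[R]_n) : dir_mx (fun m => A m + B m + C m) v =
    dir_mx A v + dir_mx B v + dir_mx C v.
  by rewrite /dir_mx -!big_split; apply: eq_bigr => i _; rewrite /= !scalerDr.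
have D1 : dir_mx D v = dir_mx K v *m H *m J^T + J *m dir_mx E w *m J^T
    + J *m H *m (dir_mx K v)^T.
  rewrite /D dirE; congr (_ + _ + _).
  - by rewrite /dir_mx !mulmx_suml; apply: eq_bigr => i _; rewrite !scalemxAl.
  - have -> : dir_mx E w = \sum_i v 0 i *: dir_mx E (row i J).
      apply/matrixP => a b; rewrite dir_mxE summxE.
      transitivity (\sum_c \sum_i v 0 i * J i c * E c a b).
        by apply: eq_bigr => c _; rewrite mxE mulr_suml.
      rewrite exchange_big/=; apply: eq_bigr => i _; rewrite mxE dir_mxE mulr_sumr.
      by apply: eq_bigr => c _; rewrite mxE mulrA.
    rewrite mulmx_sumr mulmx_suml; apply: eq_bigr => i _.
    by rewrite -scalemxAr -scalemxAl.
  - rewrite /dir_mx linear_sum mulmx_sumr; apply: eq_bigr => i _.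
    by rewrite linearZ/= -scalemxAr.
have D2 : quad_row D v = 2 *: (w *m H *m (dir_mx K v)^T) + quad_row E w *m J^T.
  have add3 (A B C : 'M[R]_1) : (A + B + C) 0 0 = A 0 0 + B 0 0 + C 0 0 by rewrite !mxE.
  have tr00 (A : 'M[R]_1) : A^T 0 0 = A 0 0 by rewrite mxE.
  apply/rowP => m; rewrite [LHS]mxE /D !mulmxDr !mulmxDl add3.
  have -> : v *m (K m *m H *m J^T) *m v^T = (w *m H *m (K m)^T *m v^T)^T.
    by rewrite /w !trmx_mul !trmxK Hs !mulmxA.
  rewrite tr00 !mulmxA -/w.
  have -> : (w *m dir_mx E (row m J) *m J^T *m v^T) 0 0 = (quad_row E w *m J^T) 0 m.
    rewrite -mulmxA -trmx_mul -/w /dir_mx mulmx_sumr mulmx_suml summxE mxE.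
    apply: eq_bigr => a _; rewrite -scalemxAr -scalemxAl [LHS]mxE [row m J 0 a]mxE.
    by rewrite [quad_row E w 0 a]mxE [J^T a m]mxE mulrC.
  have -> : (w *m H *m (dir_mx K v)^T) = \row_a (w *m H *m (K a)^T *m v^T) 0 0.
    apply/rowP => a; rewrite [RHS]mxE.
    have -> : w *m H *m (K a)^T *m v^T = w *m H *m (v *m K a)^T by rewrite trmx_mul mulmxA.
    rewrite -rowK; move: (w *m H) (dir_mx K v) => p X.
    by rewrite [LHS]mxE [RHS]mxE; apply: eq_bigr => c _; rewrite !mxE.
  move: (quad_row E w *m J^T) (fun m => w *m H *m (K m)^T *m v^T).
  by move=> A B; rewrite !mxE; ring.
rewrite /lagrange_row D1 D2 !mulmxDr -/D !mulmxA -/w scalerDr scalerA mulVf ?pnatr_eq0//.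
rewrite scale1r mulmxDl mulmxBl -scalemxAl.
by rewrite opprD !addrA addrK.
Qed.

Definition pjac (phi : 'rV[R]_n -> 'rV[R]_n) (x : 'rV[R]_n) : 'M[R]_n :=
  \matrix_(i, a) partial i (fun y => phi y 0 a) x.

Lemma Ckmx_pjac k U phi : open U -> Ckmap k.+1 U phi -> Ckmx k U (pjac phi).
Proof.
move=> oU pU i a; apply: (Ck_ext oU _ (Ck_partial i (pU a))) => x _.
by rewrite mxE.
Qed.

Lemma dmx_comp k (U W : set 'rV[R]_n) (F : 'rV[R]_n -> 'M[R]_n) phi i x :
  open W -> Ckmx k.+1 W F -> W (phi x) -> Ckmap k.+1 U phi -> U x ->
  dmx i (F \o phi) x = dir_mx (fun a => dmx a F (phi x)) (row i (pjac phi x)).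
Proof.
move=> oW FW Wx pU Ux; apply/matrixP => a b; rewrite dmx_entry dir_mxE.
have := partial_comp i oW (FW a b) Wx pU Ux.
move/partialE => h; rewrite -[LHS]/(partial i ((fun y => F y a b) \o phi) x) h.
by apply: eq_bigr => j _; rewrite dmx_entry !mxE.
Qed.

(** The transformation law of the Christoffel symbols, contracted twice with v.
    Lowered with the metrics it is [lagrange_row_pullback]; the factor H J^T common
    to both sides is invertible. *)
Lemma spray_transport (U W : set 'rV[R]_n) G G' phi x v :
  open U -> open W -> (forall y, U y -> W (phi y)) -> Ckmap 2 U phi -> Ckmx 1 W G' ->
  (forall y, U y -> G y = pjac phi y *m G' (phi y) *m (pjac phi y)^T) ->
  (forall y, W y -> (G' y)^T = G' y) -> U x -> G x \in unitmx ->
  spray G x v *m pjac phi x =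
  spray G' (phi x) (v *m pjac phi x) + v *m dir_mx (fun i => dmx i (pjac phi) x) v.
Proof.
move=> oU oW UW pU GW GE Gs Ux G1; set J := pjac phi x; set H := G' (phi x).
have Wx := UW _ Ux.
have JU : Ckmx 1 U (pjac phi) := Ckmx_pjac oU pU.
have p1U : Ckmap 1 U phi := CkmapW (leqnSn 1) pU.
have HU : Ckmx 1 U (G' \o phi) by move=> i j; exact: (Ck_comp oU oW UW p1U (GW i j)).
have Gsym y : U y -> (G y)^T = G y.
  by move=> Uy; rewrite GE// !trmx_mul trmxK Gs ?mulmxA//; exact: UW.
have unitG : G x = J *m H *m J^T by exact: GE.
have : J *m (H *m J^T) \in unitmx by rewrite mulmxA -unitG.
rewrite unitmx_mul => /andP[_ uHJ].
have : H *m J^T \in unitmx by [].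
rewrite unitmx_mul => /andP[uH _].
have Ks m i a : dmx m (pjac phi) x i a = dmx i (pjac phi) x m a.
  pose P y : 'rV[R]_n := \row_j phi y 0 j.
  have JE q y : pjac phi y q a = dmx q P y 0 a.
    rewrite dmx_entry mxE; suff -> : (fun z => P z 0 a) = (fun z => phi z 0 a) by [].
    by apply/funext => z; rewrite mxE.
  have e p q : dmx p (pjac phi) x q a = dmx p (dmx q P) x 0 a.
    rewrite [LHS]dmx_entry [RHS]dmx_entry.
    suff -> : (fun y => pjac phi y q a) = (fun y => dmx q P y 0 a) by [].
    by apply/funext => y; exact: JE.
  have PU : Ckmx 2 U P.
    by move=> p q; apply: (Ck_ext oU _ (pU q)) => y _; rewrite mxE.
  exact: (etrans (e m i) (etrans
    (congr1 (fun A : 'M[R]_(1, n) => A 0 a) (dmx_swap m i oU PU Ux)) (esym (e i m)))).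
have dG m : dmx m G x = dmx m (pjac phi) x *m H *m J^T
    + J *m dir_mx (fun a => dmx a G' (phi x)) (row m J) *m J^T
    + J *m H *m (dmx m (pjac phi) x)^T.
  rewrite (dmx_ext m oU GE Ux).
  have JHU : Ckmx 1 U (fun y => pjac phi y *m G' (phi y)) by exact: (Ckmx_mul oU JU HU).
  rewrite (dmx_mul m JHU (Ckmx_tr oU JU) Ux) (dmx_mul m JU HU Ux) dmx_tr.
  by rewrite (dmx_comp m oW GW Wx p1U Ux) mulmxDl.
have := spray_lagrange v oU Ux Gsym G1.
have -> : (fun i => dmx i G x) = (fun m => dmx m (pjac phi) x *m H *m J^T
    + J *m dir_mx (fun a => dmx a G' (phi x)) (row m J) *m J^T
    + J *m H *m (dmx m (pjac phi) x)^T) by apply/funext.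
rewrite lagrange_row_pullback//; last exact: Gs.
rewrite -(spray_lagrange _ oW Wx Gs uH) -/H -/J -mulmxDl unitG => E.
have : (spray G x v *m J) *m (H *m J^T) =
    (v *m dir_mx (fun i => dmx i (pjac phi) x) v + spray G' (phi x) (v *m J)) *m (H *m J^T).
  by move: E; rewrite !mulmxA.
move=> /(congr1 (mulmx^~ (invmx (H *m J^T)))) /=.
by rewrite !mulmxK// addrC.
Qed.

End SprayTransport.

(** * Geodesics and their reparametrizations in coordinates *)

Section Curves.
Context {R : realType} {n : nat}.
Implicit Types (x v w : R -> 'rV[R]_n) (G : 'rV[R]_n -> 'M[R]_n) (t : R).

(** The clauses on the coordinates in [geodesic], for a curve in R^n. *)
Definition geodesic_eq_at G x t :=
  let u (i : 'I_n) (s : R) := x s 0 i in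
  let du (i : 'I_n) := derive1 (u i) in
  [/\ forall i, derivable (u i) t 1 /\ derivable (du i) t 1,
      exists i, du i t != 0
    & forall l, derive1 (du l) t +
        \sum_i \sum_j christoffel G l i j (x t) * du i t * du j t = 0].

(** The vector form of [geodesic_eq_at], to which the chain rule applies directly. *)
Definition geodesic_jet G x v t :=
  (\forall s \near t, is_derive s (1 : R) x (v s)) /\
  is_derive t (1 : R) v (- spray G (x t) (v t)).

Lemma is_derive_coord_curve x t (d : 'rV[R]_n) i :
  is_derive t (1 : R) x d -> is_derive t (1 : R) (fun s => x s 0 i) (d 0 i).
Proof.
move=> [xd <-]; apply: DeriveDef; first by move/derivable_mxP: xd.
by rewrite derive_mx// mxE.
Qed.

Lemma is_derive_continuous (V : normedModType R) (x : R -> V) t d :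
  is_derive t (1 : R) x d -> {for t, continuous x}.
Proof.
by move=> [xd _]; apply: differentiable_continuous; apply/derivable1_diffP.
Qed.

Lemma geodesic_eq_of_jet G x v t : geodesic_jet G x v t -> v t != 0 ->
  geodesic_eq_at G x t.
Proof.
move=> [xv vt] v0.
have du i : \forall s \near t, v s 0 i = derive1 (fun s => x s 0 i) s.
  apply: filterS xv => s /(is_derive_coord_curve i)[_ h].
  by rewrite derive1E h.
have dut i : derive1 (fun s => x s 0 i) t = v t 0 i by rewrite -(nbhs_singleton (du i)).
have dv i := is_derive_coord_curve i vt.
have ddu i : is_derive t (1 : R) (derive1 (fun s => x s 0 i)) ((- spray G (x t) (v t)) 0 i).
  exact: near_eq_is_derive (du i) (dv i).
split.
- move=> i; split; last by have [] := ddu i.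
  by have [] := is_derive_coord_curve i (nbhs_singleton xv).
- have [i vi] : exists i, v t 0 i != 0.
    apply: contrapT => /forallNP H; move/eqP: v0; apply; apply/rowP => i.
    by have /negP/negPn/eqP := H i; rewrite mxE.
  by exists i; rewrite dut.
move=> l; rewrite derive1E; have [_ ->] := ddu l; rewrite !mxE.
by under [X in _ + X]eq_bigr do under eq_bigr do rewrite !dut; rewrite addNr.
Qed.

Lemma jet_of_geodesic_eq G x t : (\forall s \near t, geodesic_eq_at G x s) ->
  let v s := \row_i derive1 (fun s => x s 0 i) s in
  geodesic_jet G x v t /\ v t != 0.
Proof.
move=> H v; split; last first.
  have [_ [i ui] _] := nbhs_singleton H.
  by apply: contra_neq ui => /rowP/(_ i); rewrite !mxE.
split.
  apply: filterS H => s [ud _ _]; apply: is_derive_rV => j; rewrite mxE.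
  by have [d1 _] := ud j; apply: DeriveDef => //; rewrite derive1E.
have [ud _ ode] := nbhs_singleton H.
apply: is_derive_rV => j; have [_ d2] := ud j.
have -> : (fun s => v s 0 j) = derive1 (fun s => x s 0 j).
  by apply/funext => s; rewrite mxE.
apply: DeriveDef => //; rewrite -derive1E; move/eqP: (ode j).
rewrite addr_eq0 => /eqP ->; rewrite !mxE; congr (- _).
by apply: eq_bigr => a _; apply: eq_bigr => b _; rewrite !mxE.
Qed.

Lemma geodesic_jet_transport (U W : set 'rV[R]_n) G G' phi x v t :
  open U -> open W -> (forall y, U y -> W (phi y)) -> Ckmap 2 U phi -> Ckmx 1 W G' ->
  (forall y, U y -> G y = pjac phi y *m G' (phi y) *m (pjac phi y)^T) ->
  (forall y, W y -> (G' y)^T = G' y) -> (forall y, U y -> G y \in unitmx) ->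
  U (x t) -> geodesic_jet G x v t ->
  geodesic_jet G' (phi \o x) (fun s => v s *m pjac phi (x s)) t.
Proof.
move=> oU oW UW pU GW GE Gs G1 Uxt [xv vt].
have cx := is_derive_continuous (nbhs_singleton xv).
have nU : \forall s \near t, U (x s) by exact: cx (open_nbhs_nbhs (conj oU Uxt)).
split.
  apply: filterS2 _ xv nU => s xs Us; apply: is_derive_rV => j.
  have := is_derive_comp_C1 oU (pU j) Us (fun i => is_derive_coord_curve i xs).
  move=> h; apply: (is_derive_eq h); rewrite mxE.
  by apply: eq_bigr => i _; rewrite mxE.
have JU := Ckmx_pjac oU pU.
have -> : - spray G' ((phi \o x) t) (v t *m pjac phi (x t)) =
    (- spray G (x t) (v t)) *m pjac phi (x t)
    + v t *m dir_mx (fun i => dmx i (pjac phi) (x t)) (v t).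
  rewrite mulNmx (spray_transport (v t) oU oW UW pU GW GE Gs Uxt (G1 _ Uxt)).
  by rewrite opprD addrNK.
apply: is_derive_rV => a.
have xt := nbhs_singleton xv.
have dJ i := is_derive_comp_C1 oU (JU i a) Uxt (fun i => is_derive_coord_curve i xt).
have h := is_derive_bigsum (index_enum 'I_n) xpredT
  (fun i => is_derive_mul (is_derive_coord_curve i vt) (dJ i)).
have -> : (fun y => (v y *m pjac phi (x y)) 0 a) =
    (fun s => \sum_i v s 0 i * pjac phi (x s) i a) by apply/funext => s; rewrite mxE.
apply: (is_derive_eq h); rewrite big_split /=.
have addE (A B : 'rV[R]_n) : (A + B) 0 a = A 0 a + B 0 a by rewrite mxE.
rewrite addE; congr (_ + _); first by rewrite [RHS]mxE.
rewrite [RHS]mxE; apply: eq_bigr => i _; rewrite dir_mxE; congr (_ * _).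
by apply: eq_bigr => j _; rewrite dmx_entry.
Qed.

Lemma sprayZ G (p u : 'rV[R]_n) (a : R) : spray G p (a *: u) = a ^+ 2 *: spray G p u.
Proof.
apply/rowP => l; rewrite !mxE mulr_sumr; apply: eq_bigr => i _.
by rewrite mulr_sumr; apply: eq_bigr => j _; rewrite !mxE; ring.
Qed.

Let proportional_acceleration (S S' u : 'rV[R]_n) (a q : R) j : a != 0 ->
  (- (a ^+ 2 *: S')) 0 j = q * u 0 j + a * (a * (- S) 0 j) ->
  (S' - S) 0 j = ((- q / a ^+ 2) *: u) 0 j.
Proof.
move=> a0; rewrite !mxE => E; have a2 : a ^+ 2 != 0 by rewrite expf_neq0.
apply: (mulfI a2); have -> : a ^+ 2 * (- q / a ^+ 2 * u 0 j) = - (q * u 0 j).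
  by rewrite mulrA mulrCA mulfV// mulr1 mulNr.
have -> : q * u 0 j = - (a ^+ 2 * S' 0 j) + a ^+ 2 * S 0 j by rewrite E; ring.
ring.
Qed.

(** If y = x o rho, then y' = rho' (x' o rho), and comparing the derivatives of both
    sides at t0 gives (rho')^2 (spray Gb - spray G) = - rho'' x'.  The change of
    parameter is only assumed differentiable once, but rho' is the quotient of a
    coordinate of y' by one of x' o rho, so rho'' exists at t0. *)
Lemma reparametrized_jet G Gb x v y w (rho : R -> R) t0 :
  geodesic_jet G x v (rho t0) -> v (rho t0) != 0 -> geodesic_jet Gb y w t0 ->
  (\forall s \near t0, derivable rho s 1) -> derive1 rho t0 != 0 ->
  (\forall s \near t0, y s = x (rho s)) ->
  exists kappa, spray Gb (x (rho t0)) (v (rho t0)) - spray G (x (rho t0)) (v (rho t0)) =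
    kappa *: v (rho t0).
Proof.
move=> [xv vt] v0 [yw wt] rd rho0 yx.
have rdt : is_derive t0 (1 : R) rho (derive1 rho t0).
  by apply: DeriveDef; [exact: nbhs_singleton rd|rewrite derive1E].
have rc := is_derive_continuous rdt.
have xv' : \forall s \near t0, is_derive (rho s) (1 : R) x (v (rho s)) by exact: rc xv.
have comp (f : R -> R) (df s : R) : derivable rho s 1 -> is_derive (rho s) (1 : R) f df ->
    is_derive s (1 : R) (f \o rho) (derive1 rho s * df).
  move=> ds fd; rewrite mulrC; apply: is_derive1_comp.
  by apply: DeriveDef; [exact: ds|rewrite derive1E].
have wE : \forall s \near t0, forall i, w s 0 i = derive1 rho s * v (rho s) 0 i.
  have yx' : \forall s \near t0, \forall s' \near s, y s' = x (rho s').
    exact: nbhs_interior yx.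
  near=> s => i.
  have ds : derivable rho s 1 by near: s.
  have xs : is_derive (rho s) (1 : R) x (v (rho s)) by near: s.
  have ys : is_derive s (1 : R) y (w s) by near: s.
  have h1 := comp _ _ _ ds (is_derive_coord_curve i xs).
  have [_ <-] := is_derive_coord_curve i ys; have [_ <-] := h1.
  apply: near_eq_derive; have yxs : \forall s' \near s, y s' = x (rho s') by near: s.
  by apply: filterS yxs => s' ->.
have [i vi] : exists i, v (rho t0) 0 i != 0.
  apply: contrapT => /forallNP H; move/eqP: v0; apply; apply/rowP => i.
  by have /negP/negPn/eqP := H i; rewrite mxE.
have vrho j : is_derive t0 (1 : R) (fun s => v (rho s) 0 j)
    (derive1 rho t0 * (- spray G (x (rho t0)) (v (rho t0))) 0 j).
  exact: (comp _ _ _ (nbhs_singleton rd) (is_derive_coord_curve j vt)).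
(* rho' is a quotient of differentiable functions *)
have [q rho2] : exists q, is_derive t0 (1 : R) (derive1 rho) q.
  have hq := is_derive_mul (is_derive_coord_curve i wt) (is_derive_inv vi (vrho i)).
  eexists; apply: (near_eq_is_derive _ hq).
  have vc := is_derive_continuous (vrho i).
  have vne : \forall s \near t0, v (rho s) 0 i != 0.
    exact: (cvgr_neq0 _ vc vi).
  by apply: filterS2 _ vne wE => s vs ->; rewrite mulfK.
have yt : y t0 = x (rho t0) := nbhs_singleton yx.
have wt0 : w t0 = derive1 rho t0 *: v (rho t0).
  by apply/rowP => j; rewrite (nbhs_singleton wE) mxE.
exists (- q / (derive1 rho t0) ^+ 2); apply/rowP => j.
have d1 := is_derive_coord_curve j wt.
have d2 := is_derive_mul rho2 (vrho j).
have : 'D_1 (fun s => w s 0 j) t0 = 'D_1 (fun s => derive1 rho s * v (rho s) 0 j) t0.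
  by apply: near_eq_derive; apply: filterS wE => s.
have [_ ->] := d1; have [_ ->] := d2.
rewrite yt wt0 sprayZ.
exact: (proportional_acceleration rho0).
Unshelve. all: by end_near. Qed.

End Curves.

Section ProjectiveDifference.
Context {R : realType} {n : nat}.

(** Evaluate at the basis vectors e_i and at e_i + e_j, e_i - e_j. *)
Lemma projective_quadratic (P : 'I_n -> 'I_n -> 'I_n -> R) :
  (forall k i j, P k i j = P k j i) ->
  (forall v : 'rV[R]_n, v != 0 -> exists kappa, forall k,
     \sum_i \sum_j P k i j * v 0 i * v 0 j = kappa * v 0 k) ->
  exists psi : 'I_n -> R, forall k i j,
    P k i j = (k == i)%:R * psi j + (k == j)%:R * psi i.
Proof.
move=> Ps Pv.
have e0 i : (delta_mx 0 i : 'rV[R]_n) != 0.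
  by apply/eqP => /rowP/(_ i); rewrite !mxE !eqxx => /eqP; rewrite oner_eq0.
have quad k i j (a b : R) :
    \sum_c \sum_d P k c d * (a *: delta_mx 0 i + b *: delta_mx 0 j : 'rV[R]_n) 0 c *
      (a *: delta_mx 0 i + b *: delta_mx 0 j : 'rV[R]_n) 0 d =
    a ^+ 2 * P k i i + 2 * a * b * P k i j + b ^+ 2 * P k j j.
  have lin (f : 'I_n -> R) : \sum_d f d * (a *: delta_mx 0 i + b *: delta_mx 0 j : 'rV[R]_n) 0 d
      = a * f i + b * f j.
    have one m (f' : 'I_n -> R) : \sum_d f' d * (delta_mx 0 m : 'rV[R]_n) 0 d = f' m.
      rewrite (bigD1 m)//= big1 => [|d dm]; first by rewrite mxE !eqxx mulr1 addr0.
      by rewrite mxE (negbTE dm) andbF mulr0.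
    under eq_bigr do rewrite !mxE mulrDr !(mulrCA (f _)).
    rewrite big_split/= -!mulr_sumr; congr (_ * _ + _ * _).
      by rewrite -[RHS]one; apply: eq_bigr => d _; rewrite mxE.
    by rewrite -[RHS]one; apply: eq_bigr => d _; rewrite mxE.
  transitivity (\sum_c (a * P k c i + b * P k c j) *
      (a *: delta_mx 0 i + b *: delta_mx 0 j : 'rV[R]_n) 0 c).
    apply: eq_bigr => c _; rewrite -(lin (P k c)) mulr_suml; apply: eq_bigr => d _.
    by rewrite mulrAC.
  by rewrite lin (Ps k j i); ring.
have coordE i j (a b : R) k : (a *: delta_mx 0 i + b *: delta_mx 0 j : 'rV[R]_n) 0 k =
    a * (k == i)%:R + b * (k == j)%:R by rewrite !mxE.
have diag k i : k != i -> P k i i = 0.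
  move=> ki; have [kap /(_ k)] := Pv _ (e0 i).
  have -> : delta_mx 0 i = 1 *: delta_mx 0 i + 0 *: delta_mx 0 i :> 'rV[R]_n.
    by rewrite scale1r scale0r addr0.
  by rewrite quad coordE (negbTE ki) /= => E; lra.
have mixed i j : i != j ->
    [/\ 2 * P j i j = P i i i, P j j j = 2 * P i i j &
        forall k, k != i -> k != j -> P k i j = 0].
  move=> ij.
  have nz (b : R) : (1 *: delta_mx 0 i + b *: delta_mx 0 j : 'rV[R]_n) != 0.
    apply/eqP => /rowP/(_ i); rewrite coordE eqxx (negbTE ij) mxE /= => E.
    have : (1 : R) = 0 by move: E; rewrite /=; lra.
    by move/eqP; rewrite oner_eq0.
  have [k1 K1] := Pv _ (nz 1); have [k2 K2] := Pv _ (nz (-1)).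
  have := K1 i; have := K1 j; have := K2 i; have := K2 j.
  rewrite !quad !coordE !eqxx (eq_sym j) (negbTE ij).
  rewrite (diag j i) 1?eq_sym// (diag i j)// /= => h1 h2 h3 h4.
  split; [by lra|by lra|move=> k ki kj].
  have := K1 k; rewrite quad coordE (negbTE ki) (negbTE kj) (diag k i)// (diag k j)// /=.
  by lra.
exists (fun i => 2^-1 * P i i i) => k i j.
have [ij|ij] := eqVneq i j.
  rewrite -{}ij; have [->|ki] := eqVneq k i; first by rewrite mul1r; field.
  by rewrite diag// !mul0r addr0.
have [m1 m2 m3] := mixed i j ij.
have [->|ki] := eqVneq k i.
  by rewrite (negbTE ij) mul1r mul0r addr0 m2; field.
have [->|kj] := eqVneq k j; last by rewrite m3// !mul0r addr0.
by rewrite mul0r add0r mul1r -m1; field.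
Qed.

End ProjectiveDifference.

(** * Charts, pullback metrics and the theorem *)

Section JacobianMatrix.
Context {R : realType} {n : nat}.
Implicit Types (phi psi : 'rV[R]_n -> 'rV[R]_n) (U W : set 'rV[R]_n).

Lemma jacobian_pjac U phi x : open U -> Ckmap 1 U phi -> U x -> jacobian phi x = pjac phi x.
Proof.
move=> oU pU Ux.
have dphi : differentiable phi x.
  have -> : phi = \sum_(j < n) (fun y => phi y 0 j *: (delta_mx 0 j : 'rV[R]_n)).
    by apply/funext => y; rewrite fct_sumE -row_sum_delta.
  apply: differentiable_sum => j; apply: differentiableZl.
  by have [] := Ck_is_diff oU (pU j) Ux.
apply/row_matrixP => i; rewrite rowE -deriveEjacobian// derive_mx; last exact: diff_derivable.
by apply/rowP => j; rewrite !mxE.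
Qed.

Lemma pjac_comp U W phi psi x : open W -> Ckmap 1 U phi -> Ckmap 1 W psi -> U x -> W (phi x) ->
  pjac (psi \o phi) x = pjac phi x *m pjac psi (phi x).
Proof.
move=> oW pU pW Ux Wx; apply/matrixP => i a; rewrite [LHS]mxE [RHS]mxE.
have /partialE h := partial_comp i oW (pW a) Wx pU Ux.
rewrite -[LHS]/(partial i ((fun y => psi y 0 a) \o phi) x) h.
by apply: eq_bigr => j _; rewrite !mxE.
Qed.

Lemma pjac_cancel U W phi psi x : open U -> open W -> Ckmap 1 U phi -> Ckmap 1 W psi ->
  (forall y, U y -> W (phi y)) -> (forall y, U y -> psi (phi y) = y) -> U x ->
  pjac phi x *m pjac psi (phi x) = 1%:M.
Proof.
move=> oU oW pU pW UW K Ux; rewrite -(pjac_comp oW pU pW Ux (UW _ Ux)).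
apply/matrixP => i a; rewrite [LHS]mxE.
have Ka : {in U, (fun y : 'rV[R]_n => y 0 a) =1 (fun y => (psi \o phi) y 0 a)}.
  by move=> y /set_mem Uy /=; rewrite K.
rewrite -(near_partial i oU Ux Ka) (partialE (is_derive_coord a x _)) !mxE eqxx/=.
by rewrite eq_sym.
Qed.

End JacobianMatrix.

Section Chart.
Context {R : realType} {n : nat} {M : topologicalType}.
Implicit Type c : chart R n M.

Lemma chart_mapK c p : chart_dom c p -> chart_inv c (c p) = p.
Proof. by move=> cp; apply: chart_invK; exact: mem_set. Qed.

Lemma chart_cod_inv c x : chart_cod c x ->
  chart_dom c (chart_inv c x) /\ c (chart_inv c x) = x.
Proof. by move=> [p cp <-]; rewrite chart_mapK. Qed.

Lemma chart_cod_map c p : chart_dom c p -> chart_cod c (c p).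
Proof. by move=> cp; exists p. Qed.

End Chart.

Section CoordinateExpressions.
Context {R : realType} {n : nat} {M N : topologicalType}.
Implicit Types (c : chart R n M) (d : chart R n N) (f : M -> N) (h : N -> M).

Lemma in_charts_domP c d f x : in_charts_dom c d f x <->
  chart_cod c x /\ chart_dom d (f (chart_inv c x)).
Proof.
split; first by move=> [p [cp dp] <-]; rewrite chart_mapK//; split=> //; exact: chart_cod_map.
by move=> [/chart_cod_inv[c1 c2] dx]; exists (chart_inv c x).
Qed.

Lemma in_charts_cod c d f x : in_charts_dom c d f x -> chart_cod d (in_charts c d f x).
Proof. by move=> /in_charts_domP[_]; exact: chart_cod_map. Qed.

Lemma open_in_charts_dom c d f : continuous f -> open (in_charts_dom c d f).
Proof.
move=> cf; rewrite openE => x /in_charts_domP[cx dx].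
have H1 : \forall y \near x, chart_cod c y.
  by apply: (@open_nbhs_nbhs _ x (chart_cod c)); split=> //; exact: chart_codO.
have ci : {for x, continuous (f \o chart_inv c)}.
  by apply: continuous_comp; [exact: chart_inv_cts|exact: cf].
have H2 : \forall y \near x, chart_dom d (f (chart_inv c y)).
  exact: ci (open_nbhs_nbhs (conj (chart_domO d) dx)).
by apply: filterS2 _ H1 H2 => y y1 y2; apply/in_charts_domP.
Qed.

End CoordinateExpressions.

Lemma in_charts_cancel {R : realType} {n : nat} {M N : topologicalType}
    (c : chart R n M) (d : chart R n N) (f : M -> N) (h : N -> M) x :
  cancel f h -> in_charts_dom c d f x ->
  in_charts_dom d c h (in_charts c d f x) /\ in_charts d c h (in_charts c d f x) = x.
Proof.
move=> fK /in_charts_domP[cx dx]; have [c1 c2] := chart_cod_inv cx.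
rewrite /in_charts/= chart_mapK// fK; split=> //.
by apply/in_charts_domP; rewrite chart_mapK// fK; split=> //; exact: chart_cod_map.
Qed.

Section Metrics.
Context {R : realType} {n : nat}.

Lemma metric_change_pjac k (M : manifold R n k) (g : metric M) (c d : chart R n M) x :
  (0 < k)%N -> atlas c -> atlas d -> in_charts_dom c d idfun x ->
  g c x = pjac (in_charts c d idfun) x *m g d (in_charts c d idfun x)
          *m (pjac (in_charts c d idfun) x)^T.
Proof.
move=> k0 ac ad Ux; rewrite (metric_change g ac ad Ux) /=.
have oU : open (in_charts_dom c d idfun) by apply: open_in_charts_dom => p; exact: cvg_id.
have pU : Ckmap 1 (in_charts_dom c d idfun) (in_charts c d idfun).
  by apply: CkmapW k0 (atlas_compat ac ad).
by rewrite (jacobian_pjac oU pU Ux).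
Qed.

(** The transition maps carry the geodesic equation to all other charts. *)
Lemma geodesic_of_chart_solution k (M : manifold R n k) (g : metric M) (c : chart R n M)
    (x v : R -> 'rV[R]_n) (e : R) :
  (1 < k)%N -> metric_class 1 g -> atlas c -> 0 < e ->
  (forall t, `|t| < e -> [/\ chart_cod c (x t), v t != 0, is_derive t (1 : R) x (v t) &
     is_derive t (1 : R) v (- spray (g c) (x t) (v t))]) ->
  geodesic g (ball (0 : R) e) (chart_inv c \o x).
Proof.
move=> k1 gC ac e0 sol.
have ballE t : ball (0 : R) e t -> `|t| < e by rewrite -ball_normE/= sub0r normrN.
split.
  split; first exact: ball_open.
    move=> a b /ballE ha /ballE hb t /andP[at' tb]; rewrite -ball_normE/= sub0r normrN.
    by move: ha hb; rewrite !ltr_norml => /andP[? ?] /andP[? ?]; apply/andP; split; lra.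
  by exists 0; exact: ballxx.
move=> t te; have /ballE te' := te; have [cx vt xv vv] := sol t te'.
have jet : geodesic_jet (g c) x v t.
  split=> //; apply: filterS (open_nbhs_nbhs (conj (ball_open 0 e) te)).
  by move=> s /ballE/sol[].
split.
  by apply: continuous_comp; [exact: is_derive_continuous xv|exact: chart_inv_cts].
move=> d ad dx.
pose U := in_charts_dom c d idfun; pose phi := in_charts c d idfun.
have oU : open U by apply: open_in_charts_dom => p; exact: cvg_id.
have Ux : U (x t) by apply/in_charts_domP.
have pU : Ckmap 2 U phi by apply: CkmapW k1 (atlas_compat ac ad).
have GE y : U y -> g c y = pjac phi y *m g d (phi y) *m (pjac phi y)^T.
  by move=> Uy; exact: metric_change_pjac (ltnW k1) ac ad Uy.
have G1 y : U y -> g c y \in unitmx.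
  by move=> /in_charts_domP[cy _]; exact: (metric_nondeg g ac cy).
have UW y : U y -> chart_cod d (phi y) by exact: in_charts_cod.
have Gs y : chart_cod d y -> (g d y)^T = g d y by move=> dy; exact: (Defs.metric_sym g ad dy).
have oW : open (chart_cod d) by exact: chart_codO.
have := geodesic_jet_transport oU oW UW pU (gC d ad) GE Gs G1 Ux jet.
move=> /geodesic_eq_of_jet; apply.
have : g c (x t) \in unitmx by exact: G1.
rewrite GE// !unitmx_mul => /andP[/andP[uJ _] _].
by apply: contra_neq vt => vJ; rewrite -(mulmxK uJ (v t)) vJ mul0mx.
Qed.

End Metrics.

Section GeodesicMappingInCharts.
Context {R : realType} {n r : nat}.
Hypotheses (n1 : (1 < n)%N) (r2 : (2 < r)%N).
Context {M N : manifold R n r.+1} (g : metric M) (g' : metric N).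
Hypotheses (gC : metric_class r g) (gC' : metric_class 2 g').
Context (f : M -> N) (h : N -> M).
Hypotheses (fC : Ckmorphism f) (hC : Ckmorphism h) (fK : cancel f h) (hK : cancel h f).
Hypothesis f_geo : forall (I : set R) (gamma : R -> M), geodesic g I gamma ->
  exists J : set R, exists2 delta : R -> N,
    geodesic g' J delta & same_curve I (f \o gamma) J delta.
Context (c : chart R n M) (d : chart R n N).
Hypotheses (ac : atlas c) (ad : atlas d).

(** Gb is the pullback of g' to the chart c, theta the inverse of phi. *)
Let V := in_charts_dom c d f.
Let phi := in_charts c d f.
Let W := in_charts_dom d c h.
Let theta := in_charts d c h.
Let Gb x := pjac phi x *m g' d (phi x) *m (pjac phi x)^T.

Let oV : open V. Proof. by apply: open_in_charts_dom; exact: fC.1. Qed.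
Let oW : open W. Proof. by apply: open_in_charts_dom; exact: hC.1. Qed.
Let phiC : Ckmap r.+1 V phi. Proof. exact: fC.2. Qed.
Let thetaC : Ckmap r.+1 W theta. Proof. exact: hC.2. Qed.

Let phiK x : V x -> W (phi x) /\ theta (phi x) = x.
Proof. exact: in_charts_cancel. Qed.

Let thetaK y : W y -> V (theta y) /\ phi (theta y) = y.
Proof. exact: in_charts_cancel. Qed.

Let VC x : V x -> chart_cod c x. Proof. by move=> /in_charts_domP[]. Qed.
Let WC y : W y -> chart_cod d y. Proof. by move=> /in_charts_domP[]. Qed.

Let g'_sym y : W y -> (g' d y)^T = g' d y.
Proof. by move=> /WC Wy; exact: (Defs.metric_sym g' ad Wy). Qed.

Let g'_unit y : W y -> g' d y \in unitmx.
Proof. by move=> /WC Wy; exact: (metric_nondeg g' ad Wy). Qed.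

Let g_sym x : V x -> (g c x)^T = g c x.
Proof. by move=> /VC Vx; exact: (Defs.metric_sym g ac Vx). Qed.

Let g_unit x : V x -> g c x \in unitmx.
Proof. by move=> /VC Vx; exact: (metric_nondeg g ac Vx). Qed.

Let Gb_sym x : V x -> (Gb x)^T = Gb x.
Proof.
by move=> /phiK[Wx _]; rewrite /Gb !trmx_mul trmxK g'_sym// mulmxA.
Qed.

Let Gb_unit x : V x -> Gb x \in unitmx.
Proof.
move=> Vx; have [Wx _] := phiK Vx.
have JJ := pjac_cancel oV oW (CkmapW (ltn0Sn r) phiC) (CkmapW (ltn0Sn r) thetaC)
  (fun y Vy => (phiK Vy).1) (fun y Vy => (phiK Vy).2) Vx.
have [uJ _] := mulmx1_unit JJ.
by rewrite /Gb !unitmx_mul unitmx_tr uJ g'_unit.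
Qed.

Let pullback_pushforward y : W y ->
  g' d y = pjac theta y *m Gb (theta y) *m (pjac theta y)^T.
Proof.
move=> Wy; have [Vy yK] := thetaK Wy.
have JJ := pjac_cancel oW oV (CkmapW (ltn0Sn r) thetaC) (CkmapW (ltn0Sn r) phiC)
  (fun y Vy => (thetaK Vy).1) (fun y Vy => (thetaK Vy).2) Wy.
rewrite /Gb yK !mulmxA JJ mul1mx -!mulmxA -trmx_mul.
by rewrite JJ trmx1 mulmx1.
Qed.

Let GbC k : (k <= r)%N -> Ckmx k (chart_cod d) (g' d) -> Ckmx k V Gb.
Proof.
move=> kr g'C; have JC : Ckmx k V (pjac phi) := Ckmx_pjac oV (CkmapW (kr : (k.+1 <= r.+1)%N) phiC).
have ocd : open (chart_cod d) by exact: chart_codO.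
have g'phi : Ckmx k V (g' d \o phi).
  move=> i j; apply: (Ck_comp oV ocd _ (CkmapW (leqW kr) phiC) (g'C i j)).
  by move=> x; exact: in_charts_cod.
exact: (Ckmx_mul oV (Ckmx_mul oV JC g'phi) (Ckmx_tr oV JC)).
Qed.

Let gVC : Ckmx r V (g c).
Proof. by move=> i j; apply: Ck_sub (gC ac i j). Qed.

(** Take the geodesic of g through x0 with velocity v0.  Its image is, up to the
   parameter, a geodesic of g', which read in the chart c is a geodesic of Gb with
   the same trace; compare the accelerations at x0. *)
Let spray_difference x0 (v0 : 'rV[R]_n) : V x0 -> v0 != 0 ->
  exists kappa, spray Gb x0 v0 - spray (g c) x0 v0 = kappa *: v0.
Proof.
move=> Vx0 v00.
have [x [v [e [e0 x00 v0E sol]]]] :=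
  geodesic_existence oV Vx0 v00 (CkmxW (ltnW r2) gVC) g_unit.
pose gamma := chart_inv c \o x.
have r1 : (1 <= r)%N by apply: leq_trans r2.
have g1C : metric_class 1 g by move=> c' ac' i j; exact: CkW r1 (gC ac' i j).
have solc t : `|t| < e -> [/\ chart_cod c (x t), v t != 0, is_derive t (1 : R) x (v t) &
     is_derive t (1 : R) v (- spray (g c) (x t) (v t))].
  by move=> /sol[Vxt vt xv vv]; split=> //; exact: VC.
have gamma_geo := geodesic_of_chart_solution (r1 : (1 < r.+1)%N) g1C ac e0 solc.
have [J [delta [[oJ _ _] delta_geo] [rho rhoJ rhoP]]] := f_geo gamma_geo.
have [t0 Jt0 rt0] : exists2 t, J t & rho t = 0.
  have : ball (0 : R) e 0 by exact: ballxx.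
  by rewrite -rhoJ => -[t Jt rt]; exists t.
have ball_rho t : J t -> `|rho t| < e.
  move=> Jt; have : (rho @` J) (rho t) by exists t.
  by rewrite rhoJ -ball_normE/= sub0r normrN.
have nJ : \forall t \near t0, J t by exact: open_nbhs_nbhs (conj oJ Jt0).
have delta_x t : J t -> delta t = f (chart_inv c (x (rho t))) /\ V (x (rho t)).
  by move=> Jt; have [_ _ ->] := rhoP t Jt; have [] := sol _ (ball_rho t Jt).
have delta_d t : J t -> chart_dom d (delta t).
  by move=> /delta_x[-> /in_charts_domP[]].
pose z t := d (delta t).
have zE t : J t -> z t = phi (x (rho t)) by move=> /delta_x[+ _]; rewrite /z => ->.
have zW t : J t -> W (z t).
  by move=> Jt; rewrite zE//; have [_ /phiK[]] := delta_x t Jt.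
have z_geo : \forall t \near t0, geodesic_eq_at (g' d) z t.
  apply: filterS nJ => t Jt; have [_ /(_ d ad (delta_d t Jt))] := delta_geo t Jt.
  by [].
have [z_jet _] := jet_of_geodesic_eq z_geo.
have g'1C : Ckmx 1 (chart_cod d) (g' d) by move=> i j; exact: CkW (leqnSn 1) (gC' ad i j).
have y_jet := geodesic_jet_transport oW oV (fun y Wy => (thetaK Wy).1)
  (CkmapW (r1 : (1 < r.+1)%N) thetaC) (GbC r1 g'1C) pullback_pushforward Gb_sym g'_unit
  (zW _ Jt0) z_jet.
have x_jet : geodesic_jet (g c) x v (rho t0).
  rewrite rt0; split; last by have [] := sol 0; rewrite ?normr0.
  have : \forall t \near (0 : R), ball (0 : R) e t by exact: nbhsx_ballx.
  apply: filterS => t; rewrite -ball_normE/= sub0r normrN => te.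
  by have [] := sol t te.
have yx : \forall t \near t0, (theta \o z) t = x (rho t).
  apply: filterS nJ => t Jt; rewrite /= zE//.
  by have [_ /phiK[]] := delta_x t Jt.
have rho_d : \forall t \near t0, derivable rho t 1.
  by apply: filterS nJ => t Jt; have [] := rhoP t Jt.
have v0' : v (rho t0) != 0 by rewrite rt0 v0E.
have [_ rho0 _] := rhoP t0 Jt0.
have := reparametrized_jet x_jet v0' y_jet rho_d rho0 yx.
by rewrite rt0 x00 v0E.
Qed.

Let levi_civita_equations x : V x -> exists psi : 'I_n -> R, forall k i j,
  christoffel Gb k i j x - christoffel (g c) k i j x =
  (k == i)%:R * psi j + (k == j)%:R * psi i.
Proof.
move=> Vx; apply: projective_quadratic.
  move=> k i j; rewrite (christoffel_sym k i j oV Gb_sym Vx).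
  by rewrite (christoffel_sym k i j oV g_sym Vx).
move=> v v0; have [kappa E] := spray_difference Vx v0; exists kappa => k.
have -> : kappa * v 0 k = (kappa *: v) 0 k by rewrite mxE.
rewrite -E; have -> : (spray Gb x v - spray (g c) x v) 0 k =
  spray Gb x v 0 k - spray (g c) x v 0 k by rewrite mxE [X in _ + X]mxE.
rewrite 2!mxE -sumrB; apply: eq_bigr => i _; rewrite -sumrB; apply: eq_bigr => j _.
by rewrite !mulrBl.
Qed.

(** The pullback metric Gb has class C^r on V, and g' is its pullback by theta,
    which has class C^(r+1). *)
Lemma geodesic_mapping_regularity : Ckmx r W (g' d).
Proof.
have Gb2 : Ckmx 2 V Gb by apply: GbC (ltnW r2) (gC' ad).
have GbrC := levi_civita_regularity n1 r2 oV gVC Gb2 g_sym Gb_sym g_unit Gb_unit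
  levi_civita_equations.
have JC : Ckmx r W (pjac theta) := Ckmx_pjac oW thetaC.
have GtC : Ckmx r W (Gb \o theta).
  move=> i j; apply: (Ck_comp oW oV _ (CkmapW (leqnSn r) thetaC) (GbrC i j)).
  by move=> y Wy; exact: (thetaK Wy).1.
apply: (Ckmx_ext oW _ (Ckmx_mul oW (Ckmx_mul oW JC GtC) (Ckmx_tr oW JC))).
by move=> y Wy; rewrite pullback_pushforward.
Qed.

End GeodesicMappingInCharts.

Theorem theorem2 (R : realType) (n r : nat) (hn : (2 <= n)%N) (hr : (2 < r)%N)
    (M N : manifold R n r.+1) (g : metric M) (g' : metric N)
    (hg : metric_class r g) (hg' : metric_class 2 g')
    (hf : exists f : M -> N, geodesic_mapping g g' f) :
  metric_class r g'.
Proof.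
have [f [[fC [h [fK hK hC]]] f_geo]] := hf.
move=> d ad i j; apply: Ck_local => y dy.
have [ddom dE] := chart_cod_inv dy.
have [c ac cdom] := atlas_cover (h (chart_inv d y)).
exists (in_charts_dom d c h); first by apply/in_charts_domP.
exact: (geodesic_mapping_regularity hn hr hg hg' fC hC fK hK f_geo ac ad).
Qed.
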